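(* Let $B>0$ and let $\phi\in L^2(\mathbb{R})$ be such that $\mathcal{A}\phi(0,\omega)\neq0$ for every $\omega\in[-2B,2B]$. Then for all $f,g\in\mathrm{PW}^2_B$ the following are equivalent: (1) $f=e^{i\alpha}g$ for some $\alpha\in\mathbb{R}$; (2) $|\mathcal{V}_\phi f(x,\omega)|=|\mathcal{V}_\phi g(x,\omega)|$ for all $x,\omega\in\mathbb{R}$.
   Context: For $B>0$, the Paley--Wiener space is $\mathrm{PW}^2_B:=\{f:\mathbb{C}\to\mathbb{C} \mid \exists F\in L^2([-B,B])\ \forall z\in\mathbb{C}: f(z)=\int_{-B}^B F(\xi)e^{2\pi i \xi z}\,d\xi\}$; its elements are identified with their restrictions to $\mathbb{R}$ (which lie in $L^2(\mathbb{R})$) when transforms are applied. For $f,\phi\in L^2(\mathbb{R})$ the short-time Fourier transform is $\mathcal{V}_\phi f(x,\omega)=\int_{\mathbb{R}} f(t)\overline{\phi(t-x)}e^{-2\pi i t\omega}\,dt$, and the ambiguity function of $f\in L^2(\mathbb{R})$ is $\mathcal{A}f(x,\omega):=e^{\pi i x\omega}\mathcal{V}_f f(x,\omega)$, for $x,\omega\in\mathbb{R}$. *)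

(* Defs.v *)
From HB Require Import structures.
From mathcomp Require Import all_boot all_order all_algebra.
From mathcomp Require Import all_classical all_reals all_analysis.
From mathcomp Require Import complex.
Set Implicit Arguments. Unset Strict Implicit. Unset Printing Implicit Defensive.
Import Order.TTheory GRing.Theory Num.Theory.
Import numFieldNormedType.Exports.
Local Open Scope classical_set_scope.
Local Open Scope ring_scope.

Section PW.
Variable R : realType.

Definition leb := (@lebesgue_measure R).

Definition normsq (z : R[i]) : R := (complex.Re z) ^+ 2 + (complex.Im z) ^+ 2.

Definition expi (theta : R) : R[i] := Complex (cos theta) (sin theta).

(* e^{2 pi i xi z} for real xi and complex z = a + i b :
   = e^{-2 pi xi b} (cos (2 pi xi a) + i sin (2 pi xi a)) *)
Definition cexp2pii (xi : R) (z : R[i]) : R[i] :=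
  Complex (expR (- (2 * pi * xi * complex.Im z)) * cos (2 * pi * xi * complex.Re z))
          (expR (- (2 * pi * xi * complex.Im z)) * sin (2 * pi * xi * complex.Re z)).

Definition cmeasurable (D : set R) (h : R -> R[i]) : Prop :=
  measurable_fun D (fun t => complex.Re (h t)) /\ measurable_fun D (fun t => complex.Im (h t)).

Definition L2on (D : set R) (h : R -> R[i]) : Prop :=
  cmeasurable D h /\ leb.-integrable D (fun t => (normsq (h t))%:E).

Definition cint (D : set R) (h : R -> R[i]) : R[i] :=
  Complex (Rintegral leb D (fun t => complex.Re (h t))) (Rintegral leb D (fun t => complex.Im (h t))).

Definition PW (B : R) (f : R[i] -> R[i]) : Prop :=
  exists F : R -> R[i], L2on `[- B, B] F /\
    forall z : R[i], f z = cint `[- B, B] (fun xi => F xi * cexp2pii xi z).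

Definition restrR (f : R[i] -> R[i]) : R -> R[i] := fun t => f (t%:C)%C.

Definition STFT (phi f : R -> R[i]) (x omega : R) : R[i] :=
  cint setT (fun t => f t * conjc (phi (t - x)) * expi (- (2 * pi * t * omega))).

Definition ambig (f : R -> R[i]) (x omega : R) : R[i] :=
  expi (pi * x * omega) * STFT f f x omega.

End PW.

(* Main.v *)
Require Import Defs.
From HB Require Import structures.
From mathcomp Require Import all_boot all_order all_algebra.
From mathcomp Require Import all_classical all_reals all_analysis.
From mathcomp Require Import complex.
From mathcomp Require Import measurable_realfun ring lra.
Set Implicit Arguments. Unset Strict Implicit. Unset Printing Implicit Defensive.
Import Order.TTheory GRing.Theory Num.Theory.
Import numFieldNormedType.Exports.
Import Normc.
Local Open Scope classical_set_scope.
Local Open Scope ring_scope.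

(* For fixed [x], the function [w |-> STFT phi f x w] is the Fourier transform of
   [h t = f t * conj (phi (t - x))], so its modulus determines the autocorrelation
   of [h]: the integral over [t] of [P_u t * psi_u (t - x)], where
   [P_u t = f (t + u) * conj (f t)] and [psi_u s = conj (phi (s + u)) * phi s].
   As a function of [x] this is a convolution, so if [f] and [g] have the same
   spectrogram and [D_u] is the difference of their [P_u], the product of the
   Fourier transforms of [D_u] and [psi_u] vanishes.  That of [psi_0] is, up to
   reflection, [A phi (0, .)]; it has no zero on [[-2B, 2B]], and by continuity of
   translations in L^2 neither has that of [psi_u] for small [u].  Hence the Fourier
   transform of [D_u] vanishes on [[-2B, 2B]]; since [D_u] itself is a superposition
   of frequencies in [[-2B, 2B]], it is orthogonal to itself, and [D_u = 0].
   So [f (t + u) * conj (f t) = g (t + u) * conj (g t)] for all [t] and all small [u],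
   which gives [f = c g] with [|c| = 1] near a point where [g] does not vanish, and
   then everywhere because band-limited functions are entire.
   The Fourier analysis on the line rests on the Poisson kernel: it yields both the
   uniqueness of the Fourier transform and, by Schur's test, [f \in L^2]. *)

(** The window hypothesis concerns [psi_0] alone, so it yields only an unspecified neighbourhood of
    [u = 0]. This is why products are compared locally and the constant [c] must be carried to the
    whole plane by analyticity. Equalities are pointwise throughout: [f] and [g] are transforms of
    integrable spectra, hence bounded and continuous on the line, and autocorrelations of L^2
    functions are continuous, so uniqueness holds at every point and no null sets are tracked.
    Knowing that [f] and [g] are in L^2 puts [D_u] in L^1; their boundedness then puts [D_u] in L^2
    as well. The weight [exp (- e |t|)] suits the Fourier part because both it times a cosine and
    its transform, the Poisson kernel, have elementary antiderivatives. No holomorphic function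
    appears. The spectrum of [f - c g] has bounded support, so vanishing of its transform near one
    point is turned into vanishing of all its moments, and complex exponentials are then summed as
    power series under the integral. *)

Local Notation Re := complex.Re.
Local Notation Im := complex.Im.

Local Notation intg f := ((@leb _).-integrable setT (EFin \o f)).
Local Notation RI f := (Rintegral (@leb _) setT f).
Local Notation CI h := (cint setT h).

(** * Integration over the real line *)

Section RealIntegral.
Variable R : realType.
Implicit Types f g : R -> R.

Lemma intg_measurable f : intg f -> measurable_fun setT f.
Proof. by move=> /measurable_int /measurable_EFinP. Qed.

Lemma intg_dom f g : measurable_fun setT f -> (forall x, `|f x| <= g x) ->
  intg g -> intg f.
Proof.
move=> mf fg ig; apply: le_integrable ig => //; first exact/measurable_EFinP.
move=> x _ /=; rewrite lee_fin (le_trans (fg x))//; exact: ler_norm.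
Qed.

Lemma intgD f g : intg f -> intg g -> intg (fun x => f x + g x).
Proof. by move=> fi gi; have := integrableD measurableT fi gi. Qed.

Lemma intgB f g : intg f -> intg g -> intg (fun x => f x - g x).
Proof. by move=> fi gi; have := integrableB measurableT fi gi. Qed.

Lemma intgN f : intg f -> intg (fun x => - f x).
Proof. by move=> fi; have := integrableN fi. Qed.

Lemma intgZ (k : R) f : intg f -> intg (fun x => k * f x).
Proof. by move=> fi; have := integrableZl measurableT k fi. Qed.

Lemma intg_norm f : intg f -> intg (fun x => `|f x|).
Proof. by move=> fi; have := integrable_norm fi. Qed.

Lemma intg0 : intg (fun _ : R => 0 : R).
Proof. by have := @integrable0 _ _ R (@leb R) setT. Qed.

Lemma RID f g : intg f -> intg g -> RI (fun x => f x + g x) = RI f + RI g.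
Proof. by move=> fi gi; rewrite RintegralD. Qed.

Lemma RIB f g : intg f -> intg g -> RI (fun x => f x - g x) = RI f - RI g.
Proof. by move=> fi gi; rewrite RintegralB. Qed.

Lemma RIZ (k : R) f : intg f -> RI (fun x => k * f x) = k * RI f.
Proof. by move=> fi; rewrite RintegralZl. Qed.

Lemma RIN f : intg f -> RI (fun x => - f x) = - RI f.
Proof.
move=> fi; rewrite -[RHS]mulN1r -RIZ//.
by apply: eq_Rintegral => x _; rewrite mulN1r.
Qed.

Lemma RI0 : RI (fun _ : R => 0 : R) = 0.
Proof. by rewrite /Rintegral integral0. Qed.

Lemma le_RI f g : intg f -> intg g -> (forall x, f x <= g x) -> RI f <= RI g.
Proof. by move=> fi gi fg; apply: le_Rintegral. Qed.

Lemma RI_ge0 f : (forall x, 0 <= f x) -> 0 <= RI f.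
Proof. by move=> f0; apply: Rintegral_ge0. Qed.

Lemma norm_RI f : intg f -> `|RI f| <= RI (fun x => `|f x|).
Proof. by move=> fi; apply: le_normr_Rintegral. Qed.

Lemma EFin_RI f : intg f -> (RI f)%:E = (\int[@leb R]_x (f x)%:E)%E.
Proof. by move=> fi; rewrite /Rintegral fineK//; exact: integrable_fin_num. Qed.

Lemma measurable_shift (u : R) :
  measurable_fun [set: measurableTypeR R]
    (fun x : measurableTypeR R => x + u : measurableTypeR R).
Proof. exact: measurable_funD. Qed.

(** Lebesgue measure is determined by its values on half-open intervals, and there both sides are
    the length of the interval. *)
Lemma leb_translate (u : R) (A : set (measurableTypeR R)) : measurable A ->
  pushforward (@leb R) (fun x : measurableTypeR R => x + u : measurableTypeR R) A
  = leb A.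
Proof.
pose shift : {mfun measurableTypeR R >-> measurableTypeR R} :=
  HB.pack (fun x : measurableTypeR R => x + u : measurableTypeR R)
    (isMeasurableFun.Build _ _ _ _ _ (measurable_shift u)).
move=> mA; apply/esym.
apply: (@lebesgue_measure_unique R (pushforward (@leb R) shift)) => //= _ [[a b]] _ <-.
rewrite /pushforward /leb /=.
have -> : (shift @^-1` [set` `]a, b]]) = [set` `](a - u), (b - u)]] :> set R.
  apply/seteqP; split=> x /=; rewrite !in_itv/= ltrBlDr lerBrDr//.
rewrite !lebesgue_measure_itv/= !lte_fin ltrD2r.
by case: ifP => // _; rewrite -!EFinB; congr EFin; ring.
Qed.

Lemma leb_oppr (A : set (measurableTypeR R)) : measurable A ->
  pushforward (@leb R) (fun x : measurableTypeR R => - x : measurableTypeR R) A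
  = leb A.
Proof. exact: lebesgue_measureN. Qed.

Section MeasurePreserving.
Variable phi : measurableTypeR R -> measurableTypeR R.
Hypothesis mphi : measurable_fun setT phi.
Hypothesis leb_phi : forall A, measurable A -> pushforward (@leb R) phi A = leb A.

Let ge0_integral_comp (f : R -> \bar R) : measurable_fun setT f ->
  (forall x, 0 <= f x)%E ->
  (\int[@leb R]_x f (phi x) = \int[@leb R]_x f x)%E.
Proof.
move=> mf f0.
have := @ge0_integral_pushforward _ _ _ _ R _ mphi (@leb R) setT f measurableT mf.
rewrite preimage_setT => <-; last by move=> *; exact: f0.
pose mu : {measure set (measurableTypeR R) -> \bar R} :=
  measure_function_pushforward__canonical__measure_function_Measure (@leb R) mphi.
by apply: (@eq_measure_integral _ _ _ _ (@leb R) mu) => A mA _; exact: leb_phi.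
Qed.

Lemma intg_comp f : intg f -> intg (fun x => f (phi x)).
Proof.
move=> fi; have mf := intg_measurable fi.
have mfu : measurable_fun setT (fun x : R => f (phi x)).
  exact: (measurableT_comp mf mphi).
apply/integrableP; split; first exact/measurable_EFinP.
rewrite [X in (X < _)%E](_ : _ = \int[@leb R]_x `|(f x)%:E|)%E.
  by move/integrableP : fi => [].
rewrite -(@ge0_integral_comp (fun x => `|(f x)%:E|)%E)//.
by apply: measurableT_comp => //; apply/measurable_EFinP.
Qed.

Lemma RI_comp f : intg f -> RI (fun x => f (phi x)) = RI f.
Proof.
move=> fi; have mf := intg_measurable fi.
have ge0case g : intg g -> (forall x, 0 <= g x) -> RI (fun x => g (phi x)) = RI g.
  move=> gi g0; rewrite /Rintegral; congr fine.
  apply: (@ge0_integral_comp (fun x => (g x)%:E)) => //.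
  by apply/measurable_EFinP; exact: intg_measurable.
(* Writing [f] as [(f + |f|) - |f|] reduces the claim to two nonnegative integrable functions. *)
have i1 : intg (fun x => f x + `|f x|) by apply: intgD => //; exact: intg_norm.
have i2 := intg_norm fi.
have s1 := intg_comp i1; have s2 := intg_comp i2.
transitivity (RI (fun x => (f (phi x) + `|f (phi x)|) - `|f (phi x)|)).
  by apply: eq_Rintegral => x _; rewrite addrK.
rewrite (RIB s1 s2) (ge0case _ i1); last first.
  by move=> x; rewrite -lerBlDl sub0r -normrN ler_norm.
rewrite (ge0case _ i2)// -(RIB i1 i2).
by apply: eq_Rintegral => x _; rewrite addrK.
Qed.

End MeasurePreserving.

Lemma intg_shift f u : intg f -> intg (fun x => f (x + u)).
Proof. exact: (intg_comp (measurable_shift u) (@leb_translate u)). Qed.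

Lemma RI_shift f u : intg f -> RI (fun x => f (x + u)) = RI f.
Proof. exact: (RI_comp (measurable_shift u) (@leb_translate u)). Qed.

Lemma RI_oppr f : intg f -> RI (fun x => f (- x)) = RI f.
Proof. exact: (RI_comp (@oppr_measurable _ _) leb_oppr). Qed.

End RealIntegral.

Section RealFubini.
Variable R : realType.
Notation RR := (measurableTypeR R * measurableTypeR R)%type.

(* The slices are integrable everywhere, and not only almost everywhere, so that
   no junk value of [Rintegral] enters the iterated integrals. *)
Lemma RFubini (h : RR -> R) (p : R -> R) : measurable_fun setT h ->
  intg p -> (forall x, intg (fun y => h (x, y))) ->
  (forall x, RI (fun y => `|h (x, y)|) <= p x) ->
  (forall y, intg (fun x => h (x, y))) ->
  [/\ intg (fun x => RI (fun y => h (x, y))),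
      intg (fun y => RI (fun x => h (x, y))) &
      RI (fun x => RI (fun y => h (x, y))) = RI (fun y => RI (fun x => h (x, y)))].
Proof.
move=> mh ip ix hp iy.
have ih : ((@leb R) \x (@leb R))%E.-integrable setT (EFin \o h).
  apply/integrable12ltyP; first exact/measurable_EFinP.
  apply: le_lt_trans (integrable_lty measurableT ip).
  apply: ge0_le_integral => //.
  - by move=> x _; apply: integral_ge0.
  - apply: (measurable_fun_fubini_tonelli_F (fun z => `|(h z)%:E|)%E) => //.
    by apply: measurableT_comp => //; exact/measurable_EFinP.
  - exact: measurable_int ip.
  - move=> x _ /=; rewrite -EFin_RI ?lee_fin//; exact: (intg_norm (ix x)).
have e1 : (fun x => (RI (fun y => h (x, y)))%:E) =
    (fun x => \int[@leb R]_y (EFin \o h) (x, y))%E.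
  by apply/funext => x; rewrite EFin_RI//; exact: ix.
have e2 : (fun y => (RI (fun x => h (x, y)))%:E) =
    (fun y => \int[@leb R]_x (EFin \o h) (x, y))%E.
  by apply/funext => y; rewrite EFin_RI//; exact: iy.
split.
- by rewrite /comp e1; exact: integrable_fubini_F.
- rewrite /comp e2; have mG := measurable_fubini_G ih.
  apply/integrableP; split; first exact: mG.
  apply: le_lt_trans ((integrable21ltyP _ _ _).1 ih); last exact/measurable_EFinP.
  have mah : measurable_fun setT (fun z => `|(h z)%:E|)%E.
    by apply: measurableT_comp => //; exact/measurable_EFinP.
  apply: ge0_le_integral => //.
  - by apply: measurableT_comp => //; exact: measurable_fubini_G.
  - exact: (measurable_fun_fubini_tonelli_G (fun z => `|(h z)%:E|)%E).
  - by move=> y _; apply: le_abse_integral => //; exact: measurable_int (iy y).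
- by rewrite /Rintegral e1 e2; congr fine; apply: Fubini.
Qed.

End RealFubini.

(** * Complex-valued functions *)

Section ComplexNumbers.
Variable R : realType.
Implicit Types z w : R[i].

Lemma complex_eqP z w : Re z = Re w -> Im z = Im w -> z = w.
Proof. by case: z w => a b [c d] /= -> ->. Qed.

Lemma cReM z w : Re (z * w) = Re z * Re w - Im z * Im w.
Proof. by case: z w => a b [c d]. Qed.

Lemma cImM z w : Im (z * w) = Re z * Im w + Im z * Re w.
Proof. by case: z w => a b [c d]. Qed.

Lemma cReD z w : Re (z + w) = Re z + Re w.
Proof. by case: z w => a b [c d]. Qed.

Lemma cImD z w : Im (z + w) = Im z + Im w.
Proof. by case: z w => a b [c d]. Qed.

Lemma cReN z : Re (- z) = - Re z.
Proof. by case: z. Qed.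

Lemma cImN z : Im (- z) = - Im z.
Proof. by case: z. Qed.

Lemma cReJ z : Re (conjc z) = Re z.
Proof. by case: z. Qed.

Lemma cImJ z : Im (conjc z) = - Im z.
Proof. by case: z. Qed.

Lemma conjcM z w : conjc (z * w) = conjc z * conjc w.
Proof.
by apply: complex_eqP; rewrite ?cReJ ?cImJ ?cReM ?cImM ?cReJ ?cImJ; ring.
Qed.

Lemma conjcB z w : conjc (z - w) = conjc z - conjc w.
Proof.
by apply: complex_eqP; rewrite ?cReJ ?cImJ ?cReD ?cImD ?cReN ?cImN ?cReJ ?cImJ ?cImD ?cImN; ring.
Qed.

Lemma conjcMz z : z * conjc z = (normsq z)%:C%C.
Proof.
by apply: complex_eqP; rewrite ?cReM ?cImM ?cReJ ?cImJ /= /normsq; ring.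
Qed.

Lemma normc_sq z : normc z ^+ 2 = normsq z.
Proof. by case: z => a b; rewrite /normc sqr_sqrtr// addr_ge0// sqr_ge0. Qed.

Lemma normc_ge0 z : 0 <= normc z.
Proof. by case: z => a b; rewrite /normc sqrtr_ge0. Qed.

Lemma normsq_ge0 z : 0 <= normsq z.
Proof. by rewrite /normsq addr_ge0// sqr_ge0. Qed.

Lemma normsq_eq0 z : normsq z = 0 -> z = 0.
Proof.
rewrite -normc_sq => /eqP; rewrite sqrf_eq0 => /eqP; exact: eq0_normc.
Qed.

Lemma normsqM z w : normsq (z * w) = normsq z * normsq w.
Proof. by rewrite -!normc_sq normcM exprMn. Qed.

Lemma cnormJ z : normc (conjc z) = normc z.
Proof. by case: z => a b; rewrite /normc /= sqrrN. Qed.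

Lemma normc_Re z : `|Re z| <= normc z.
Proof.
by case: z => a b /=; rewrite -sqrtr_sqr ler_wsqrtr// lerDl sqr_ge0.
Qed.

Lemma normc_Im z : `|Im z| <= normc z.
Proof.
by case: z => a b /=; rewrite -sqrtr_sqr ler_wsqrtr// lerDr sqr_ge0.
Qed.

Lemma le_normc_ReIm z : normc z <= `|Re z| + `|Im z|.
Proof.
case: z => a b /=; rewrite -[leRHS]ger0_norm ?addr_ge0// -sqrtr_sqr.
rewrite ler_wsqrtr// sqrrD !real_normK ?num_real//.
by rewrite -addrA lerD2l lerDr mulrn_wge0// mulr_ge0.
Qed.

Lemma le_normcB z w : normc (z - w) <= normc z + normc w.
Proof. by rewrite -[normc w]normcN le_normcD. Qed.

Lemma normc_real (a : R) : normc a%:C%C = `|a|.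
Proof. by rewrite /normc /= expr0n/= addr0 sqrtr_sqr. Qed.

Lemma expiD (a b : R) : expi (a + b) = expi a * expi b.
Proof.
apply: complex_eqP; rewrite ?cReM ?cImM /= ?cosD ?sinD; ring.
Qed.

Lemma expi0 : expi (0 : R) = 1.
Proof. by rewrite /expi cos0 sin0. Qed.

Lemma expiN (a : R) : expi (- a) = conjc (expi a).
Proof. by apply: complex_eqP; rewrite /= ?cosN ?sinN. Qed.

Lemma normc_expi (a : R) : normc (expi a) = 1.
Proof. by rewrite /normc /expi cos2Dsin2 sqrtr1. Qed.

Lemma normCE z : `|z| = (normc z)%:C%C.
Proof. by case: z. Qed.

(** A weak form of the inequality between geometric and arithmetic means. It serves to show that a
    product of two square-integrable functions is integrable, so the factor 1/2 is dropped. *)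
Lemma normc_le_normsq z w : normc (z * w) <= normsq z + normsq w.
Proof.
rewrite normcM -!normc_sq.
have := sqr_ge0 (normc z - normc w); have := normc_ge0 z; have := normc_ge0 w.
by move: (normc z) (normc w) => a b ? ? ?; nra.
Qed.

Definition ee (x : R) : R[i] := expi (2 * pi * x).

Lemma eeD x y : ee (x + y) = ee x * ee y.
Proof. by rewrite /ee mulrDr expiD. Qed.

Lemma eeN x : ee (- x) = conjc (ee x).
Proof. by rewrite /ee mulrN expiN. Qed.

Lemma ee0 : ee 0 = 1.
Proof. by rewrite /ee mulr0 expi0. Qed.

Lemma normc_ee x : normc (ee x) = 1.
Proof. exact: normc_expi. Qed.

End ComplexNumbers.

Section ComplexMeasurable.
Variable R : realType.
Context d (T : measurableType d).
Implicit Types h k : T -> R[i].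

Definition cmeas h :=
  measurable_fun setT (fun x => Re (h x)) /\
  measurable_fun setT (fun x => Im (h x)).

Lemma cmeas_cst (c : R[i]) : cmeas (fun=> c).
Proof. by split; exact: measurable_cst. Qed.

Lemma cmeasM h k : cmeas h -> cmeas k -> cmeas (fun x => h x * k x).
Proof.
move=> [h1 h2] [k1 k2]; split.
  under eq_fun do rewrite cReM.
  by apply: measurable_funB; apply: measurable_funM.
under eq_fun do rewrite cImM.
by apply: measurable_funD; apply: measurable_funM.
Qed.

Lemma cmeasD h k : cmeas h -> cmeas k -> cmeas (fun x => h x + k x).
Proof.
move=> [h1 h2] [k1 k2]; split.
  by under eq_fun do rewrite cReD; apply: measurable_funD.
by under eq_fun do rewrite cImD; apply: measurable_funD.
Qed.

Lemma cmeasN h : cmeas h -> cmeas (fun x => - h x).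
Proof.
move=> [h1 h2]; split.
  by under eq_fun do rewrite cReN; apply: measurableT_comp.
by under eq_fun do rewrite cImN; apply: measurableT_comp.
Qed.

Lemma cmeasB h k : cmeas h -> cmeas k -> cmeas (fun x => h x - k x).
Proof. by move=> mh mk; apply: cmeasD => //; exact: cmeasN. Qed.

Lemma cmeasJ h : cmeas h -> cmeas (fun x => conjc (h x)).
Proof.
move=> [h1 h2]; split; first by under eq_fun do rewrite cReJ.
by under eq_fun do rewrite cImJ; apply: measurableT_comp.
Qed.

Lemma cmeas_expi (f : T -> R) : measurable_fun setT f ->
  cmeas (fun x => expi (f x)).
Proof.
move=> mf; split => /=.
  by apply: measurableT_comp => //; apply: continuous_measurable_fun; exact: continuous_cos.
by apply: measurableT_comp => //; apply: continuous_measurable_fun; exact: continuous_sin.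
Qed.

Lemma cmeas_ee (f : T -> R) : measurable_fun setT f ->
  cmeas (fun x => ee (f x)).
Proof. by move=> mf; apply: cmeas_expi; apply: measurable_funM. Qed.

Lemma cmeas_real (f : T -> R) : measurable_fun setT f ->
  cmeas (fun x => (f x)%:C%C).
Proof. by move=> mf; split => //=; exact: measurable_cst. Qed.

Lemma measurable_normsq h : cmeas h -> measurable_fun setT (fun x => normsq (h x)).
Proof.
by move=> [h1 h2]; apply: measurable_funD; apply: measurable_funX.
Qed.

Lemma measurable_normc h : cmeas h -> measurable_fun setT (fun x => normc (h x)).
Proof.
move=> mh; have := measurable_normsq mh.
have -> : (fun x => normc (h x)) = (fun x => Num.sqrt (normsq (h x))).
  by apply/funext => x; rewrite /normsq; case: (h x).
move=> ?; apply: measurableT_comp => //; apply: continuous_measurable_fun.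
exact: sqrt_continuous.
Qed.

End ComplexMeasurable.

Lemma cmeas_comp (R : realType) d d' (T : measurableType d) (T' : measurableType d')
  (h : T -> R[i]) (f : T' -> T) : cmeas h -> measurable_fun setT f ->
  cmeas (fun x => h (f x)).
Proof.
move=> [h1 h2] mf; split.
  exact: (measurableT_comp h1 mf).
exact: (measurableT_comp h2 mf).
Qed.

Section ComplexIntegral.
Variable R : realType.
Implicit Types h k : R -> R[i].

Definition cL1 h := intg (fun x => Re (h x)) /\ intg (fun x => Im (h x)).

Lemma cL1_cmeas h : cL1 h -> cmeas h.
Proof. by move=> [h1 h2]; split; exact: intg_measurable. Qed.

Lemma cL1_dom h (g : R -> R) : cmeas h -> (forall x, normc (h x) <= g x) ->
  intg g -> cL1 h.
Proof.
move=> [m1 m2] hg ig; split; apply: intg_dom ig => // x.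
  exact: le_trans (normc_Re _) (hg x).
exact: le_trans (normc_Im _) (hg x).
Qed.

Lemma cL1_normc h : cL1 h -> intg (fun x => normc (h x)).
Proof.
move=> hi; have mh := cL1_cmeas hi; case: hi => h1 h2.
apply: intg_dom (intgD (intg_norm h1) (intg_norm h2)).
  exact: measurable_normc.
by move=> x; rewrite ger0_norm ?normc_ge0// le_normc_ReIm.
Qed.

Lemma cL1D h k : cL1 h -> cL1 k -> cL1 (fun x => h x + k x).
Proof.
move=> [h1 h2] [k1 k2]; split.
  by under eq_fun do rewrite cReD; exact: intgD.
by under eq_fun do rewrite cImD; exact: intgD.
Qed.

Lemma cL1N h : cL1 h -> cL1 (fun x => - h x).
Proof.
move=> [h1 h2]; split.
  by under eq_fun do rewrite cReN; exact: intgN.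
by under eq_fun do rewrite cImN; exact: intgN.
Qed.

Lemma cL1B h k : cL1 h -> cL1 k -> cL1 (fun x => h x - k x).
Proof. by move=> hi ki; apply: cL1D => //; exact: cL1N. Qed.

Lemma cL1J h : cL1 h -> cL1 (fun x => conjc (h x)).
Proof.
move=> [h1 h2]; split; first by under eq_fun do rewrite cReJ.
by under eq_fun do rewrite cImJ; exact: intgN.
Qed.

Lemma cL1Mb h k (M : R) : cL1 h -> cmeas k -> (forall x, normc (k x) <= M) ->
  cL1 (fun x => h x * k x).
Proof.
move=> hi mk kM; have ni := intgZ M (cL1_normc hi).
apply: cL1_dom ni; first exact: cmeasM (cL1_cmeas hi) mk.
by move=> x; rewrite normcM mulrC ler_wpM2r// normc_ge0.
Qed.

Lemma cL1Zl (c : R[i]) h : cL1 h -> cL1 (fun x => c * h x).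
Proof.
move=> hi; under eq_fun do rewrite mulrC.
by apply: cL1Mb hi (cmeas_cst _ _) (fun=> lexx _).
Qed.

Lemma cL1_shift h u : cL1 h -> cL1 (fun x => h (x + u)).
Proof.
by move=> [h1 h2]; split; [exact: (intg_shift u h1)|exact: (intg_shift u h2)].
Qed.

Lemma CI_shift h u : cL1 h -> CI (fun x => h (x + u)) = CI h.
Proof.
move=> [h1 h2]; rewrite /cint.
by rewrite (RI_shift u h1) (RI_shift u h2).
Qed.

Lemma eq_CI h k : (forall x, h x = k x) -> CI h = CI k.
Proof. by move=> hk; congr cint; apply/funext. Qed.

Lemma CID h k : cL1 h -> cL1 k -> CI (fun x => h x + k x) = CI h + CI k.
Proof.
move=> [h1 h2] [k1 k2]; apply: complex_eqP; rewrite ?cReD ?cImD /= -RID//;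
  by apply: eq_Rintegral => x _; rewrite ?cReD ?cImD.
Qed.

Lemma CIN h : cL1 h -> CI (fun x => - h x) = - CI h.
Proof.
move=> [h1 h2]; apply: complex_eqP; rewrite ?cReN ?cImN /= -RIN//;
  by apply: eq_Rintegral => x _; rewrite ?cReN ?cImN.
Qed.

Lemma CIB h k : cL1 h -> cL1 k -> CI (fun x => h x - k x) = CI h - CI k.
Proof. by move=> hi ki; rewrite CID ?CIN//; exact: cL1N. Qed.

Lemma CIJ h : cL1 h -> CI (fun x => conjc (h x)) = conjc (CI h).
Proof.
move=> [h1 h2]; apply: complex_eqP; rewrite ?cReJ ?cImJ /= -?RIN//;
  by apply: eq_Rintegral => x _; rewrite ?cReJ ?cImJ.
Qed.

Lemma CI0 : CI (fun _ : R => 0 : R[i]) = 0.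
Proof. by apply: complex_eqP; rewrite /= RI0. Qed.

Lemma CIZl (c : R[i]) h : cL1 h -> CI (fun x => c * h x) = c * CI h.
Proof.
move=> [h1 h2]; apply: complex_eqP; rewrite ?cReM ?cImM /= -!RIZ//.
  rewrite -RIB; [|exact: intgZ|exact: intgZ].
  by apply: eq_Rintegral => x _; rewrite cReM.
rewrite -RID; [|exact: intgZ|exact: intgZ].
by apply: eq_Rintegral => x _; rewrite cImM.
Qed.

Lemma CIZr (c : R[i]) h : cL1 h -> CI (fun x => h x * c) = CI h * c.
Proof.
by move=> hi; rewrite mulrC -CIZl//; apply: eq_CI => x; rewrite mulrC.
Qed.

(** The integral [z] is rotated onto the real axis: [normsq z] is the real part of the integral of
    [conjc z * h], and that integrand has modulus [normc z * normc (h x)]. Dividing by [normc z]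
    gives the bound with constant 1, which separate estimates of the two components would not. *)
Lemma normc_CI h : cL1 h -> normc (CI h) <= RI (fun x => normc (h x)).
Proof.
move=> hi; set z := CI h; have ni := cL1_normc hi.
have [->|z0] := eqVneq z 0.
  by rewrite normc0 RI_ge0// => x; exact: normc_ge0.
have nz : 0 < normc z.
  by rewrite lt_neqAle normc_ge0 andbT eq_sym; apply: contra z0 => /eqP/eq0_normc ->.
rewrite -(ler_pM2l nz) -expr2 normc_sq.
have zi := cL1Zl (conjc z) hi.
have -> : normsq z = Re (CI (fun x => conjc z * h x)).
  by rewrite CIZl// -/z mulrC conjcMz.
move: zi; move: (z) => {nz z0 ni}{}z zi; rewrite /= -RIZ//; last exact: cL1_normc.
apply: le_RI; [by case: zi|by apply: intgZ; exact: cL1_normc|].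
move=> x; apply: le_trans (ler_norm _) _; apply: le_trans (normc_Re _) _.
by rewrite normcM cnormJ.
Qed.

Lemma CI_le h (g : R -> R) : cL1 h -> intg g -> (forall x, normc (h x) <= g x) ->
  normc (CI h) <= RI g.
Proof.
move=> hi gi hg; apply: le_trans (normc_CI hi) _.
by apply: le_RI => //; exact: cL1_normc.
Qed.

End ComplexIntegral.

Section ComplexFubini.
Variable R : realType.
Notation RR := (measurableTypeR R * measurableTypeR R)%type.

Lemma CFubini (h : RR -> R[i]) (p : R -> R) : cmeas h ->
  intg p -> (forall x, cL1 (fun y => h (x, y))) ->
  (forall x, RI (fun y => normc (h (x, y))) <= p x) ->
  (forall y, cL1 (fun x => h (x, y))) ->
  [/\ cL1 (fun x => CI (fun y => h (x, y))),
      cL1 (fun y => CI (fun x => h (x, y))) &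
      CI (fun x => CI (fun y => h (x, y))) = CI (fun y => CI (fun x => h (x, y)))].
Proof.
move=> [m1 m2] ip ix hp iy.
have [|||r1 r2 r3] := RFubini m1 ip.
- by move=> x; case: (ix x).
- move=> x; apply: le_trans (hp x); apply: le_RI.
  + by apply: intg_norm; case: (ix x).
  + exact: cL1_normc.
  + by move=> y; exact: normc_Re.
- by move=> x; case: (iy x).
have [|||s1 s2 s3] := RFubini m2 ip.
- by move=> x; case: (ix x).
- move=> x; apply: le_trans (hp x); apply: le_RI.
  + by apply: intg_norm; case: (ix x).
  + exact: cL1_normc.
  + by move=> y; exact: normc_Im.
- by move=> x; case: (iy x).
split; [exact: (conj r1 s1)|exact: (conj r2 s2)|].
rewrite /cint.
exact: (f_equal2 (@Complex R) r3 s3).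
Qed.

End ComplexFubini.

(** * Fourier transform and Poisson kernel *)

Section FourierTransform.
Variable R : realType.
Implicit Types h k F a : R -> R[i].
Notation RR := (measurableTypeR R * measurableTypeR R)%type.

(** The exponent has a plus sign so that a band-limited function is [ft] of its spectrum; a
    short-time transform at [omega] is then a value of [ft] at [- omega]. *)
Definition ft F (t : R) : R[i] := CI (fun xi => F xi * ee (xi * t)).

Lemma measurable_fstR : measurable_fun [set: RR] (fun z : RR => z.1 : R).
Proof. exact: measurable_fst. Qed.

Lemma measurable_sndR : measurable_fun [set: RR] (fun z : RR => z.2 : R).
Proof. exact: measurable_snd. Qed.

Lemma cmeas_eeM (t : R) : cmeas (fun x : R => ee (x * t)).
Proof. by apply: cmeas_ee; apply: measurable_funM. Qed.

Lemma cL1_ft F t : cL1 F -> cL1 (fun xi => F xi * ee (xi * t)).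
Proof.
by move=> Fi; apply: (cL1Mb (M := 1)) => //; [exact: cmeas_eeM|move=> x; rewrite normc_ee].
Qed.

Lemma normc_ft F t : cL1 F -> normc (ft F t) <= RI (fun x => normc (F x)).
Proof.
move=> Fi; apply: CI_le; [exact: cL1_ft|exact: cL1_normc|].
by move=> x; rewrite normcM normc_ee mulr1.
Qed.

(** Fubini for [a x * F y * ee (y * x)], dominated by [normc (a x) * normc (F y)]. Inversion, the
    L^2 bound and the orthogonality of band-limited functions all come from this multiplication
    formula. *)
Let ft_mul_subproof a F : cL1 a -> cL1 F -> cL1 (fun t => a t * ft F t) /\
  CI (fun t => a t * ft F t) = CI (fun x => F x * ft a x).
Proof.
move=> ai Fi.
pose h (z : RR) := a z.1 * (F z.2 * ee (z.2 * z.1)).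
have mh : cmeas h.
  apply: cmeasM; first exact: cmeas_comp (cL1_cmeas ai) measurable_fstR.
  apply: cmeasM; first exact: cmeas_comp (cL1_cmeas Fi) measurable_sndR.
  by apply: cmeas_ee; apply: measurable_funM; [exact: measurable_sndR|exact: measurable_fstR].
have ip : intg (fun x => RI (fun y => normc (F y)) * normc (a x)).
  by apply: intgZ; exact: cL1_normc.
have [|||r1 _ e] := CFubini mh ip.
- by move=> x; rewrite /h /=; apply: cL1Zl; exact: cL1_ft.
- move=> x; rewrite mulrC -RIZ; last exact: cL1_normc.
  apply: le_RI.
  + by rewrite /h /=; apply: cL1_normc; apply: cL1Zl; exact: cL1_ft.
  + by apply: intgZ; exact: cL1_normc.
  + by move=> y; rewrite /h /= !normcM normc_ee mulr1.
- move=> y; rewrite /h /=.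
  have -> : (fun x => a x * (F y * ee (y * x))) = (fun x => F y * (a x * ee (x * y))).
    by apply/funext => x; rewrite [y * x]mulrC; ring.
  by apply: cL1Zl; exact: cL1_ft.
have E x : a x * ft F x = CI (fun y => h (x, y)).
  by rewrite /ft -(CIZl (a x) (cL1_ft x Fi)).
rewrite (funext E); split; first exact: r1.
rewrite e; apply: eq_CI => y; rewrite /ft -(CIZl (F y) (cL1_ft y ai)).
by apply: eq_CI => x; rewrite /h /= [y * x]mulrC; ring.
Qed.

Lemma cL1_mul_ft a F : cL1 a -> cL1 F -> cL1 (fun t => a t * ft F t).
Proof. by move=> ai Fi; have [] := ft_mul_subproof ai Fi. Qed.

Lemma ft_mul a F : cL1 a -> cL1 F ->
  CI (fun t => a t * ft F t) = CI (fun x => F x * ft a x).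
Proof. by move=> ai Fi; have [] := ft_mul_subproof ai Fi. Qed.

End FourierTransform.

Section PoissonKernel.
Variable R : realType.

(** Evenness doubles the half-line integral, which the fundamental theorem of calculus evaluates.
    The derivative is asked for on positive reals only, so that integrands involving [|x|] are
    covered. Nonnegativity lets the integral be computed before integrability is known. *)
Lemma even_intg (f F : R -> R) (l : R) : (forall x, 0 <= f x) ->
  continuous f -> (forall x, f (- x) = f x) ->
  continuous F -> (forall x : R, 0 < x -> is_derive x (1 : R) F (f x)) ->
  F x @[x --> +oo] --> l ->
  intg f /\ RI f = 2 * (l - F 0).
Proof.
move=> f0 cf ev cF dF Fl.
have mf : measurable_fun setT f by exact: continuous_measurable_fun.
have e : (\int[@leb R]_x (f x)%:E = (2 * (l - F 0))%:E)%E.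
  rewrite (ge0_symfun_integralT f0 cf) ?EFinM; last by move=> x /=; rewrite ev.
  congr (_ * _)%E; rewrite -set_itvcy EFinB.
  apply: (ge0_continuous_FTC2y (f := f)) => //.
  - by apply: continuous_subspaceT.
  - by move=> x x0; have ? := dF _ x0; exact: ex_derive.
  - by apply: cvg_at_right_filter; exact: cF.
  - move=> x; rewrite in_itv/= andbT => x0.
    by rewrite derive1E; have ? := dF _ x0; exact: derive_val.
split; last by rewrite /Rintegral e.
apply/integrableP; split; first exact/measurable_EFinP.
under eq_integral do rewrite gee0_abs ?lee_fin//=.
by rewrite e ltry.
Qed.

Definition ptw (e t : R) : R := expR (- (e * `|t|)).

(** The Poisson kernel of the upper half-plane at height [e / (2 * pi)]. *)
Definition pk (e v : R) : R := 2 * e / (e ^+ 2 + (2 * pi * v) ^+ 2).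

Lemma derivable_continuous (F : R -> R) :
  (forall x, exists d, is_derive x (1 : R) F d) -> continuous F.
Proof.
move=> dF x; apply: differentiable_continuous; apply/derivable1_diffP.
by have [d ?] := dF x; exact: ex_derive.
Qed.

Lemma continuous_ptw (e : R) : continuous (ptw e).
Proof.
move=> x; rewrite /ptw.
apply: (@continuous_comp _ _ _ (fun t => - (e * `|t|)) expR); last exact: continuous_expR.
apply: cvgN; apply: cvgM; first exact: cvg_cst.
exact: norm_continuous.
Qed.

Lemma ptw_gt0 e t : 0 < ptw e t.
Proof. exact: expR_gt0. Qed.

Lemma cvg_expRNM (e : R) : 0 < e -> expR (- (e * x)) @[x --> +oo] --> 0.
Proof.
move=> e0.
apply: (@cvg_comp _ _ _ (fun x => e * x) (fun y => expR (- y)) _ (pinfty_nbhs R));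
  last exact: cvgr_expR.
by apply: gt0_cvgMry.
Qed.

(** The summand 1 makes the integrand nonnegative, as [even_intg] requires. The case [c = 0] gives
    the integral of [ptw e], and subtracting it leaves the cosine integral. *)
Lemma ptw_cos (e c : R) : 0 < e ->
  intg (fun x => ptw e x * (1 + cos (c * x))) /\
  RI (fun x => ptw e x * (1 + cos (c * x))) = 2 * (e / (e ^+ 2 + c ^+ 2) + e^-1).
Proof.
move=> e0.
have D0 : 0 < e ^+ 2 + c ^+ 2 by rewrite ltr_pwDl ?exprn_gt0// sqr_ge0.
(* An antiderivative on the positive half-line, found by integrating by parts twice. It decays like
   [expR (- (e * x))], hence the limit 0 at infinity. *)
pose F x := (e ^+ 2 + c ^+ 2)^-1 * (expR (- (e * x)) * (c * sin (c * x) - e * cos (c * x)))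
  - e^-1 * expR (- (e * x)).
have dF (x : R) : is_derive x (1 : R) F (expR (- (e * x)) * (1 + cos (c * x))).
  rewrite /F; apply: is_derive_eq; rewrite /GRing.scale /=.
  by field; rewrite !gt_eqF.
have [] := @even_intg (fun x => ptw e x * (1 + cos (c * x))) F 0.
- move=> x; rewrite mulr_ge0 ?(ltW (ptw_gt0 _ _))//.
- move=> x; apply: cvgM; first exact: continuous_ptw.
  apply: cvgD; first exact: cvg_cst.
  apply: (@continuous_comp _ _ _ (fun x => c * x) cos); last exact: continuous_cos.
  by apply: cvgM; [exact: cvg_cst|exact: cvg_id].
- by move=> x; rewrite /ptw normrN mulrN cosN.
- by apply: derivable_continuous => x; eexists; exact: dF.
- by move=> x x0; rewrite /ptw gtr0_norm//; exact: dF.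
- pose K := (e ^+ 2 + c ^+ 2)^-1 * (`|c| + e) + e^-1.
  have K0 x : `|F x| <= K * expR (- (e * x)).
    rewrite /F /K; apply: le_trans (ler_normB _ _) _.
    set E := expR _; set X := c * sin _ - _; have E0 : 0 < E := expR_gt0 _.
    have -> : `|(e ^+ 2 + c ^+ 2)^-1 * (E * X)| = (e ^+ 2 + c ^+ 2)^-1 * (E * `|X|).
      by rewrite !normrM (gtr0_norm E0) gtr0_norm ?invr_gt0.
    have -> : `|e^-1 * E| = e^-1 * E by rewrite gtr0_norm// mulr_gt0 ?invr_gt0.
    rewrite [leRHS]mulrDl lerD2r -[leRHS]mulrA ler_pM2l ?invr_gt0// [leRHS]mulrC.
    rewrite ler_pM2l//; apply: le_trans (ler_normB _ _) _; rewrite !normrM (gtr0_norm e0).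
    apply: lerD; rewrite -[leRHS]mulr1 ler_wpM2l// ?(ltW e0)//.
      by rewrite ler_norml sin_le1 sin_geN1.
    by rewrite ler_norml cos_le1 cos_geN1.
  have KE : K * expR (- (e * x)) @[x --> +oo] --> 0.
    rewrite -[X in _ --> X](mulr0 K); apply: cvgM; first exact: cvg_cst.
    exact: cvg_expRNM.
  have KN : - (K * expR (- (e * x))) @[x --> +oo] --> 0.
    by rewrite -oppr0; apply: cvgN.
  apply: (squeeze_cvgr _ KN KE).
  by near=> x; rewrite -ler_norml K0.
move=> i1 i2; split => //; rewrite i2 /F !mulr0 oppr0 expR0 sin0 cos0.
by field; rewrite !gt_eqF.
Unshelve. all: by end_near. Qed.

Lemma intg_ptw (e : R) : 0 < e -> intg (ptw e) /\ RI (ptw e) = 2 / e.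
Proof.
move=> e0; have [i1 i2] := ptw_cos 0 e0.
have E : (fun x => ptw e x * (1 + cos (0 * x))) = (fun x => 2 * ptw e x).
  by apply/funext => x; rewrite mul0r cos0; ring.
have ip : intg (ptw e).
  have -> : ptw e = (fun x => 2^-1 * (ptw e x * (1 + cos (0 * x)))).
    by apply/funext => x; rewrite mul0r cos0; field.
  exact: intgZ.
split => //; move: i2; rewrite E RIZ// => i2.
apply: (mulfI (x := 2)); first by rewrite pnatr_eq0.
by rewrite i2; field; rewrite gt_eqF//= expr0n /= addr0 expf_neq0// gt_eqF.
Qed.

Lemma cL1_real (f : R -> R) : intg f -> cL1 (fun x => (f x)%:C%C).
Proof. by move=> fi; split => //=; exact: intg0. Qed.

Lemma CI_real (f : R -> R) : CI (fun x => (f x)%:C%C) = (RI f)%:C%C.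
Proof. by apply: complex_eqP => //=; exact: RI0. Qed.

Lemma ft_ptw (e v : R) : 0 < e -> ft (fun x => (ptw e x)%:C%C) v = (pk e v)%:C%C.
Proof.
move=> e0; have [ip Ip] := intg_ptw e0.
have [i1 i2] := ptw_cos (2 * pi * v) e0.
have [j1 j2] := cL1_ft v (cL1_real ip).
have Re_ee x : complex.Re ((ptw e x)%:C%C * ee (x * v)) = ptw e x * cos (2 * pi * (x * v)).
  by rewrite cReM /= mul0r subr0.
have Im_ee x : complex.Im ((ptw e x)%:C%C * ee (x * v)) = ptw e x * sin (2 * pi * (x * v)).
  by rewrite cImM /= mul0r addr0.
rewrite (funext Re_ee) in j1; rewrite (funext Im_ee) in j2.
apply: complex_eqP => /=.
  rewrite (funext Re_ee).
  transitivity (RI (fun x => ptw e x * (1 + cos (2 * pi * v * x)) - ptw e x)).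
    apply: eq_Rintegral => x _.
    by rewrite (_ : 2 * pi * v * x = 2 * pi * (x * v)); ring.
  rewrite RIB// i2 Ip /pk; field.
  by rewrite !gt_eqF//= ltr_pwDl ?exprn_gt0// sqr_ge0.
rewrite (funext Im_ee).
(* The imaginary part has an odd integrand, so its integral equals its own opposite. *)
have := RI_oppr j2.
have -> : (fun x => ptw e (- x) * sin (2 * pi * (- x * v))) =
    (fun x => - (ptw e x * sin (2 * pi * (x * v)))).
  by apply/funext => x; rewrite /ptw normrN mulNr mulrN sinN mulrN.
rewrite RIN//; lra.
Qed.

Lemma pk_gt0 e v : 0 < e -> 0 < pk e v.
Proof.
move=> e0; rewrite /pk divr_gt0 ?mulr_gt0//.
by rewrite ltr_pwDl ?exprn_gt0// sqr_ge0.
Qed.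

Lemma pkN e v : pk e (- v) = pk e v.
Proof. by rewrite /pk mulrN sqrrN. Qed.

(** The antiderivative is an arctangent divided by [pi], with limit 1/2 at infinity and value 0 at
    the origin. *)
Lemma intg_pk (e : R) : 0 < e -> intg (pk e) /\ RI (pk e) = 1.
Proof.
move=> e0; have p0 := @pi_gt0 R.
have D0 x : 0 < e ^+ 2 + (2 * pi * x) ^+ 2 by rewrite ltr_pwDl ?exprn_gt0// sqr_ge0.
pose F x := pi^-1 * atan (2 * pi / e * x).
have dF (x : R) : is_derive x (1 : R) F (pk e x).
  rewrite /F; apply: is_derive_eq; rewrite /GRing.scale /= /pk.
  move: (D0 x) p0; clear D0 F; move: (@pi R) => q D0 q0.
  by field; rewrite !gt_eqF.
have [] := @even_intg (pk e) F 2^-1.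
- by move=> x; exact/ltW/pk_gt0.
- move=> x; rewrite /pk; apply: cvgM; first exact: cvg_cst.
  apply: cvgV; first by rewrite gt_eqF.
  apply: cvgD; first exact: cvg_cst.
  apply: (@continuous_comp _ _ _ (fun x => 2 * pi * x) (fun x => x ^+ 2)).
    by apply: cvgM; [exact: cvg_cst|exact: cvg_id].
  exact: exprn_continuous.
- by move=> x; rewrite pkN.
- by apply: derivable_continuous => x; eexists; exact: dF.
- have -> : 2^-1 = pi^-1 * (pi / 2) :> R.
    by clear -p0; move: (@pi R) p0 => q q0; field; rewrite gt_eqF.
  apply: cvgM; first exact: cvg_cst.
  apply: (@cvg_comp _ _ _ (fun x => 2 * pi / e * x) atan _ (pinfty_nbhs R)); last exact: cvgy_atan.
  by apply: gt0_cvgMry => //; rewrite divr_gt0// mulr_gt0.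
by move=> i1 i2; split => //; rewrite i2 /F mulr0 atan0 mulr0 subr0 divff.
Qed.

(** Measurability is borrowed from Fubini: [ptw 1 t * ft F t] is integrable by the multiplication
    formula, and multiplying by [expR |t|] removes the weight. *)
Lemma cmeas_ft (F : R -> R[i]) : cL1 F -> cmeas (ft F).
Proof.
move=> Fi; have [ip _] := intg_ptw (@ltr01 R).
have E t : ft F t = (expR `|t|)%:C%C * ((ptw 1 t)%:C%C * ft F t).
  by rewrite mulrA -rmorphM /= /ptw mul1r -expRD subrr expR0 mul1r.
rewrite (funext E); apply: cmeasM; last exact: cL1_cmeas (cL1_mul_ft (cL1_real ip) Fi).
by apply: cmeas_real; apply: measurableT_comp => //; exact: measurableT_comp.
Qed.

End PoissonKernel.

(** * Inversion and the Plancherel bound *)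

Section Inversion.
Variable R : realType.

Lemma pk_le (e v : R) : 0 < e -> pk e v <= 2 / e.
Proof.
move=> e0; rewrite /pk.
have -> : 2 / e = 2 * e / e ^+ 2 by field; rewrite gt_eqF.
rewrite ler_pM2l ?mulr_gt0// lef_pV2 ?posrE ?exprn_gt0// ?lerDl ?sqr_ge0//.
by rewrite ltr_pwDl ?exprn_gt0// sqr_ge0.
Qed.

(** Two tail bounds of order [e], for two kinds of factor. The uniform one is enough against an
    integrable function; against a constant the bound must itself be integrable, and a multiple of
    [pk 1] is. *)
Lemma pk_far (e v d : R) : 0 < e -> 0 < d -> d <= `|v| ->
  pk e v <= e * (2 / (2 * pi * d) ^+ 2) /\
  pk e v <= e * (1 + ((2 * pi * d) ^+ 2)^-1) * pk 1 v.
Proof.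
move=> e0 d0 dv; rewrite /pk.
have p0 := @pi_gt0 R.
have A0 : 0 < (2 * pi * d) ^+ 2 by rewrite exprn_gt0// !mulr_gt0.
have Ay : (2 * pi * d) ^+ 2 <= (2 * pi * v) ^+ 2.
  rewrite -[leRHS]real_normK ?num_real// lerXn2r ?nnegrE//; first by rewrite !mulr_ge0// ltW.
  by rewrite normrM ger0_norm ?mulr_ge0 ?(ltW p0)// ler_pM2l// mulr_gt0.
move: ((2 * pi * d) ^+ 2) ((2 * pi * v) ^+ 2) A0 Ay => A y A0 Ay.
have y0 : 0 < y by exact: lt_le_trans Ay.
have ey : 0 < e ^+ 2 + y by rewrite ltr_pwDl ?exprn_gt0// ltW.
split.
  rewrite mulrA [e * 2]mulrC ler_pM2l ?mulr_gt0// lef_pV2 ?posrE//.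
  by apply: le_trans Ay _; rewrite lerDr sqr_ge0.
rewrite expr1n mulr1.
apply: (@le_trans _ _ (2 * e / y)).
  by rewrite ler_pM2l ?mulr_gt0// lef_pV2 ?posrE// lerDr sqr_ge0.
rewrite (_ : e * (1 + A^-1) * (2 / (1 + y)) = 2 * e * ((1 + A^-1) / (1 + y))); last first.
  by field; rewrite !gt_eqF//= addr_gt0.
rewrite ler_pM2l ?mulr_gt0// ler_pdivlMr ?addr_gt0// mulrC mulrDl mul1r.
rewrite mulfV ?gt_eqF// addrC lerD2l.
by rewrite lef_pV2 ?posrE.
Qed.

Lemma intgM_pk (r : R -> R) (e : R) : 0 < e -> intg r -> intg (fun x => r x * pk e x).
Proof.
move=> e0 ir; have [ip _] := intg_pk e0.
apply: intg_dom (intgZ (2 / e) (intg_norm ir)).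
  by apply: measurable_funM; exact: intg_measurable.
move=> x; rewrite normrM mulrC (gtr0_norm (pk_gt0 _ e0)) ler_wpM2r//.
exact: pk_le.
Qed.

(** The kernels [pk e] form an approximate identity as [e] tends to 0: [r 0] is the integral of
    [(r 0 - r x) * pk e x], where points near 0 contribute at most half of [|r 0|] and the tail is
    of order [e]. *)
Lemma inversion_real (r : R -> R) : intg r ->
  (forall eta, 0 < eta -> exists2 d, 0 < d & forall x, `|x| < d -> `|r x - r 0| <= eta) ->
  (forall e : R, 0 < e -> RI (fun x => r x * pk e x) = 0) -> r 0 = 0.
Proof.
move=> ir cr r0; apply/eqP; apply: contraT => n0.
have a0 : 0 < `|r 0| by rewrite normr_gt0.
have [|d d0 hd] := cr (`|r 0| / 2); first by rewrite divr_gt0.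
have A0 : 0 < (2 * pi * d) ^+ 2 by rewrite exprn_gt0// !mulr_gt0// pi_gt0.
pose A := (2 * pi * d) ^+ 2.
(* The first summand bounds the tail of [r], the second the tail of the constant [r 0], through the
   two halves of [pk_far]. *)
pose K := 2 / A * RI (fun x => `|r x|) + `|r 0| * (1 + A^-1).
have K0 : 0 <= K.
  rewrite addr_ge0 ?mulr_ge0 ?RI_ge0// ?invr_ge0 ?(ltW A0)//.
  by rewrite addr_ge0 ?invr_ge0 ?(ltW A0).
have claim e : 0 < e -> `|r 0| <= `|r 0| / 2 + e * K.
  move=> e0; have [ip Ip] := intg_pk e0; have [ip1 Ip1] := intg_pk (@ltr01 R).
  have i1 := intgZ (r 0) ip; have i2 := intgM_pk e0 ir.
  have E : r 0 = RI (fun x => r 0 * pk e x - r x * pk e x).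
    by rewrite RIB// RIZ// Ip r0// mulr1 subr0.
  rewrite {1}E; apply: le_trans (norm_RI (intgB i1 i2)) _.
  have j1 := intgZ (`|r 0| / 2) ip.
  have j2 := intgZ (2 / A) (intg_norm ir).
  have j3 := intgZ (`|r 0| * (1 + A^-1)) ip1.
  have j4 := intgZ e (intgD j2 j3).
  have -> : `|r 0| / 2 + e * K = RI (fun x => `|r 0| / 2 * pk e x +
      e * (2 / A * `|r x| + `|r 0| * (1 + A^-1) * pk 1 x)).
    rewrite (RID j1 j4) (RIZ _ ip) Ip mulr1 (RIZ e (intgD j2 j3)) (RID j2 j3).
    by rewrite (RIZ _ (intg_norm ir)) (RIZ _ ip1) Ip1 mulr1.
  apply: le_RI.
  - exact: intg_norm (intgB i1 i2).
  - exact: intgD.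
  - move=> x; rewrite -mulrBl normrM (gtr0_norm (pk_gt0 _ e0)).
    have pe := ltW (pk_gt0 x e0); have p1 := ltW (pk_gt0 x (@ltr01 R)).
    have [xd|dx] := ltP `|x| d.
      apply: ler_wpDr.
        have c1 : 0 <= 2 / A by rewrite divr_ge0// ltW.
        have c2 : 0 <= `|r 0| * (1 + A^-1) by rewrite mulr_ge0// addr_ge0// invr_ge0 ltW.
        by apply: mulr_ge0; [exact: ltW|apply: addr_ge0; exact: mulr_ge0].
      by rewrite ler_wpM2r// distrC; exact: hd.
    have [f1 f2] := pk_far e0 d0 dx.
    apply: ler_wpDl; first by rewrite mulr_ge0// divr_ge0.
    apply: (@le_trans _ _ ((`|r 0| + `|r x|) * pk e x)).
      by rewrite ler_wpM2r// ler_normB.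
    rewrite mulrDl addrC mulrDr; apply: lerD.
      by rewrite [leRHS]mulrA [leRHS]mulrC ler_wpM2l.
    rewrite (_ : e * (`|r 0| * (1 + A^-1) * pk 1 x) =
        `|r 0| * (e * (1 + A^-1) * pk 1 x)); last by ring.
    by rewrite ler_wpM2l.
(* This [e] makes [e * K] at most a quarter of [|r 0|], so [|r 0|] would be at most three quarters
   of itself. *)
have := claim (`|r 0| / 4 / (K + 1)).
have K1 : 0 < K + 1 by rewrite ltr_wpDl.
rewrite divr_gt0// ?divr_gt0// => /(_ isT).
have : `|r 0| / 4 / (K + 1) * K <= `|r 0| / 4.
  by rewrite -mulrA ler_piMr ?divr_ge0// mulrC ler_pdivrMr// mul1r lerDl.
by move: (_ * K) => z; lra.
Qed.

(** Since [pk e] is the transform of [ptw e], the multiplication formula turns the integral of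
    [k * pk e] into that of [ptw e * ft k], which is 0. *)
Lemma ft_eq0_at0 (k : R -> R[i]) : cL1 k ->
  (forall eta, 0 < eta -> exists2 d, 0 < d & forall x, `|x| < d -> normc (k x - k 0) <= eta) ->
  (forall v, ft k v = 0) -> k 0 = 0.
Proof.
move=> ki ck k0.
have E e : 0 < e -> CI (fun x => k x * (pk e x)%:C%C) = 0.
  move=> e0; have [ip _] := intg_ptw e0.
  transitivity (CI (fun x => k x * ft (fun x => (ptw e x)%:C%C) x)).
    by apply: eq_CI => x; rewrite ft_ptw.
  rewrite -(ft_mul (cL1_real ip) ki) -[RHS](@CI0 R); apply: eq_CI => x.
  by rewrite k0 mulr0.
have [k1 k2] := ki.
apply: complex_eqP => /=.
  apply: (inversion_real k1).
    move=> eta /ck[d d0 hd]; exists d => // x /hd; apply: le_trans.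
    by rewrite -cReN -cReD; exact: normc_Re.
  move=> e /E /(congr1 (@complex.Re R)) /= <-.
  by congr (Rintegral _ _ _); apply/funext => x; rewrite cReM /= mulr0 subr0.
apply: (inversion_real k2).
  move=> eta /ck[d d0 hd]; exists d => // x /hd; apply: le_trans.
  by rewrite -cImN -cImD; exact: normc_Im.
move=> e /E /(congr1 (@complex.Im R)) /= <-.
by congr (Rintegral _ _ _); apply/funext => x; rewrite cImM /= mulr0 add0r.
Qed.

Lemma ft_shift (k : R -> R[i]) (u v : R) : cL1 k ->
  ft (fun x => k (x + u)) v = ee (- (u * v)) * ft k v.
Proof.
move=> ki; rewrite /ft -(CI_shift u (cL1_ft v ki)) -CIZl; last exact: cL1_shift (cL1_ft v ki).
apply: eq_CI => x; rewrite mulrDl eeD.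
rewrite (_ : ee (- (u * v)) * _ =
  k (x + u) * ee (x * v) * (ee (- (u * v)) * ee (u * v))); last by ring.
by rewrite -eeD addNr ee0 mulr1.
Qed.

Lemma ft_eq0 (k : R -> R[i]) : cL1 k ->
  (forall u eta, 0 < eta -> exists2 d, 0 < d &
    forall x, `|x| < d -> normc (k (x + u) - k u) <= eta) ->
  (forall v, ft k v = 0) -> forall u, k u = 0.
Proof.
move=> ki ck k0 u; have := @ft_eq0_at0 (fun x => k (x + u)).
rewrite add0r; apply.
- exact: cL1_shift.
- exact: ck.
- by move=> v; rewrite ft_shift// k0 mulr0.
Qed.

End Inversion.

Section Plancherel.
Variable R : realType.
Notation RR := (measurableTypeR R * measurableTypeR R)%type.

Lemma RI_conv_pk (q : R -> R) (e : R) : 0 < e -> intg q -> (forall x, 0 <= q x) ->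
  intg (fun x => RI (fun y => q y * pk e (y - x))) /\
  RI (fun x => RI (fun y => q y * pk e (y - x))) = RI q.
Proof.
move=> e0 iq q0; have [ip Ip] := intg_pk e0.
pose h (z : RR) := q z.1 * pk e (z.1 - z.2).
have ip' y : intg (fun x => pk e (y - x)) /\ RI (fun x => pk e (y - x)) = 1.
  have -> : (fun x => pk e (y - x)) = (fun x => pk e (x + - y)).
    by apply/funext => x; rewrite -pkN opprB.
  by split; [exact: (intg_shift (- y) ip)|rewrite (RI_shift (- y) ip)].
have mh : measurable_fun setT h.
  apply: measurable_funM.
    exact: measurableT_comp (intg_measurable iq) (@measurable_fstR R).
  apply: (measurableT_comp (intg_measurable ip)).
  by apply: measurable_funB; [exact: measurable_fstR|exact: measurable_sndR].
have [|||r1 r2 r3] := RFubini mh iq.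
- by move=> y; rewrite /h /=; apply: intgZ; case: (ip' y).
- move=> y; rewrite /h /=.
  have -> : (fun x => `|q y * pk e (y - x)|) = (fun x => q y * pk e (y - x)).
    by apply/funext => x; rewrite ger0_norm// mulr_ge0// ltW// pk_gt0.
  by have [i1 i2] := ip' y; rewrite RIZ// i2 mulr1.
- move=> x; rewrite /h /=.
  apply: intg_dom (intgZ (2 / e) iq).
    apply: measurable_funM; first exact: intg_measurable iq.
    apply: (measurableT_comp (intg_measurable ip)).
    by apply: measurable_funB.
  move=> y; rewrite normrM ger0_norm// mulrC ler_wpM2r//.
  by rewrite ger0_norm ?pk_le// ltW// pk_gt0.
split; first exact: r2.
rewrite -r3; congr (Rintegral _ _ _); apply/funext => y.
by have [i1 i2] := ip' y; rewrite /h /= RIZ// i2 mulr1.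
Qed.

Lemma cL1_ptwM (k : R -> R[i]) (e M : R) : 0 < e -> cmeas k ->
  (forall x, normc (k x) <= M) -> cL1 (fun x => (ptw e x)%:C%C * k x).
Proof.
move=> e0 mk kM; apply: cL1Mb mk kM; apply: cL1_real.
by have [] := intg_ptw e0.
Qed.

Lemma ft_ptw_shift (e xi eta : R) : 0 < e ->
  ft (fun t => (ptw e t)%:C%C * ee (- (t * xi))) eta = (pk e (eta - xi))%:C%C.
Proof.
move=> e0; rewrite -ft_ptw//; apply: eq_CI => t.
by rewrite -mulrA -eeD; congr (_ * ee _); ring.
Qed.

(* Schur's test with the Poisson kernel [pk e], whose integral is [1] for every [e]. *)
Lemma weighted_plancherel (F : R -> R[i]) (e : R) : cL1 F ->
  intg (fun x => normsq (F x)) -> 0 < e ->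
  intg (fun t => ptw e t * normsq (ft F t)) /\
  RI (fun t => ptw e t * normsq (ft F t)) <= RI (fun x => normsq (F x)).
Proof.
move=> Fi F2 e0; have mf := cmeas_ft Fi; set f := ft F; have [ip Ip] := intg_pk e0.
pose M := RI (fun x => normc (F x)).
have fM t : normc (f t) <= M by exact: normc_ft.
have fJM t : normc (conjc (f t)) <= M by rewrite cnormJ.
have ai := cL1_ptwM e0 (cmeasJ mf) fJM.
have afE : (fun t => (ptw e t)%:C%C * conjc (f t) * f t) =
    (fun t => (ptw e t * normsq (f t))%:C%C).
  apply/funext => t; rewrite -mulrA [_ * f t]mulrC conjcMz.
  by rewrite -rmorphM.
have afi := cL1Mb ai mf fM.
have wfi : intg (fun t => ptw e t * normsq (f t)).
  by have [] : cL1 (fun t => (ptw e t * normsq (f t))%:C%C) by rewrite -afE.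
split => //.
pose N xi := RI (fun eta => normsq (F eta) * pk e (eta - xi)).
have [Ni NI] := RI_conv_pk e0 F2 (fun x => normsq_ge0 (F x)).
have ftaE xi : ft (fun t => (ptw e t)%:C%C * conjc (f t)) xi =
    conjc (CI (fun eta => F eta * (pk e (eta - xi))%:C%C)).
  have bi : cL1 (fun t => (ptw e t)%:C%C * ee (- (t * xi))).
    apply: (cL1_ptwM (M := 1)) => //; last by move=> x; rewrite normc_ee.
    by apply: cmeas_ee; apply: measurableT_comp => //; apply: measurable_funM.
  transitivity (conjc (CI (fun t => (ptw e t)%:C%C * ee (- (t * xi)) * f t))).
    rewrite -CIJ; last exact: cL1Mb bi mf fM.
    apply: eq_CI => t; rewrite !conjcM eeN.
    have -> : conjc (conjc (ee (t * xi))) = ee (t * xi).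
      by apply: complex_eqP; rewrite ?cReJ ?cImJ ?opprK.
    have -> : conjc (ptw e t)%:C%C = (ptw e t)%:C%C.
      by apply: complex_eqP; rewrite ?cReJ ?cImJ //= oppr0.
    by ring.
  rewrite (ft_mul bi Fi); congr conjc; apply: eq_CI => eta.
  by rewrite ft_ptw_shift.
have sh xi : intg (fun eta => pk e (eta - xi)) /\ RI (fun eta => pk e (eta - xi)) = 1.
  by split; [exact: (intg_shift (- xi) ip)|rewrite (RI_shift (- xi) ip)].
have mpk (xi : R) : measurable_fun setT (fun eta : R => pk e (eta - xi)).
  by case: (sh xi) => /intg_measurable.
have pkM xi eta : normc (pk e (eta - xi))%:C%C <= 2 / e.
  by rewrite normc_real ger0_norm ?pk_le// ltW// pk_gt0.
have Fpk xi : cL1 (fun eta => F eta * (pk e (eta - xi))%:C%C).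
  by apply: (cL1Mb (M := 2 / e)) => //; exact: cmeas_real.
have N1 xi : intg (fun eta => normsq (F eta) * pk e (eta - xi)).
  apply: intg_dom (intgZ (2 / e) F2).
    by apply: measurable_funM => //; exact: intg_measurable F2.
  move=> eta; rewrite normrM ger0_norm ?normsq_ge0// mulrC ler_wpM2r ?normsq_ge0//.
  by rewrite ger0_norm ?pk_le// ltW// pk_gt0.
(* The multiplication formula makes the integral of [G] equal to the weighted integral to be
   bounded. Applying [2 a b <= a ^+ 2 + b ^+ 2] to [normc (F xi) * normc (F eta)] bounds it by the
   mean of two integrals, both equal to that of [normsq (F x)]. *)
pose G xi := F xi * ft (fun t => (ptw e t)%:C%C * conjc (f t)) xi.
have GB xi : normc (G xi) <= 2^-1 * (normsq (F xi) + N xi).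
  rewrite /G ftaE normcM cnormJ.
  have i1 : intg (fun eta => normsq (F xi) * pk e (eta - xi)).
    by apply: intgZ; case: (sh xi).
  have i2 := N1 xi.
  have -> : 2^-1 * (normsq (F xi) + N xi) = RI (fun eta =>
      2^-1 * (normsq (F xi) * pk e (eta - xi) + normsq (F eta) * pk e (eta - xi))).
    rewrite (RIZ _ (intgD i1 i2)) (RID i1 i2) RIZ; last by case: (sh xi).
    by case: (sh xi) => _ ->; rewrite mulr1.
  apply: le_trans (ler_wpM2l (normc_ge0 _) (normc_CI (Fpk xi))) _.
  rewrite -RIZ; last exact: cL1_normc.
  apply: le_RI; [by apply: intgZ; exact: cL1_normc|by apply: intgZ; exact: intgD|].
  move=> eta; rewrite normcM normc_real ger0_norm; last exact/ltW/pk_gt0.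
  rewrite -!normc_sq -mulrDl mulrA [leRHS]mulrA ler_wpM2r//; first exact/ltW/pk_gt0.
  have := sqr_ge0 (normc (F xi) - normc (F eta)).
  by move: (normc (F xi)) (normc (F eta)) => a b; nra.
have Gi : cL1 G by exact: cL1_mul_ft.
have HN := intgZ 2^-1 (intgD F2 Ni).
have E : (RI (fun t => ptw e t * normsq (f t)))%:C%C = CI G.
  by rewrite -(ft_mul ai Fi) afE CI_real.
apply: (@le_trans _ _ (normc (CI G))).
  by rewrite -E normc_real ler_norm.
apply: le_trans (CI_le Gi HN GB) _.
rewrite (RIZ _ (intgD F2 Ni)) (RID F2 Ni) NI; lra.
Qed.

(** The weights [ptw e] with [e = 1 / (n + 1)] increase to 1, and the bound of [weighted_plancherel]
    is independent of [e], so monotone convergence applies. *)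
Lemma ft_L2 (F : R -> R[i]) : cL1 F -> intg (fun x => normsq (F x)) ->
  intg (fun t => normsq (ft F t)).
Proof.
move=> Fi F2; have mf := cmeas_ft Fi.
pose g (n : nat) (t : R) := (ptw n.+1%:R^-1 t * normsq (ft F t))%:E.
have e0 n : 0 < n.+1%:R^-1 :> R by rewrite invr_gt0.
have lg t : (fun n => g n t) @ \oo --> (normsq (ft F t))%:E.
  rewrite /g; apply/fine_cvgP; split; first by near=> n.
  rewrite [X in _ --> X](_ : _ = 1 * normsq (ft F t)) ?mul1r// /comp /=.
  have w1 : ptw n.+1%:R^-1 t @[n --> \oo] --> (1 : R).
    rewrite /ptw.
    apply: (@cvg_comp _ _ _ (fun n : nat => - (n.+1%:R^-1 * `|t|)) expR _ (nbhs (0 : R))).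
      have := cvgN (cvgM (@cvg_harmonic R) (cvg_cst `|t|)).
      by rewrite mul0r oppr0; apply.
    by have := @continuous_expR R 0; rewrite /continuous_at expR0; apply.
  by have := cvgM w1 (cvg_cst (normsq (ft F t))); rewrite mul1r; apply.
have mg n : measurable_fun setT (g n).
  apply/measurable_EFinP; apply: measurable_funM; last exact: measurable_normsq.
  by apply: continuous_measurable_fun; exact: continuous_ptw.
have g0 n x : setT x -> (0 <= g n x)%E.
  by move=> _; rewrite lee_fin mulr_ge0 ?normsq_ge0// ltW// ptw_gt0.
have ndg x : setT x -> {homo g^~ x : n m / (n <= m)%N >-> (n <= m)%E}.
  move=> _ n m nm; rewrite lee_fin ler_wpM2r ?normsq_ge0// /ptw ler_expR lerN2.
  by rewrite ler_wpM2r// lef_pV2 ?posrE// ler_nat.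
apply/integrableP; split; first exact/measurable_EFinP/measurable_normsq.
have -> : (\int[@leb R]_x `|(EFin \o (fun t => normsq (ft F t))) x|)%E =
    limn (fun n => \int[@leb R]_x g n x)%E.
  rewrite -monotone_convergence//; apply: eq_integral => x _ /=.
  by rewrite ger0_norm ?normsq_ge0//; apply/esym/cvg_lim => //; exact: lg.
apply: (@le_lt_trans _ _ (RI (fun x => normsq (F x)))%:E); last exact: ltry.
apply: lime_le.
  apply: ereal_nondecreasing_is_cvgn => n m nm.
  by apply: ge0_le_integral => //;
    first [exact: g0|exact: mg|move=> x xT; exact: (ndg x xT n m nm)].
near=> n; have [i1 i2] := weighted_plancherel Fi F2 (e0 n).
by rewrite /g -EFin_RI// lee_fin.
Unshelve. all: by end_near. Qed.

End Plancherel.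

(** * Continuity of Fourier transforms and of translations *)

Section Dominated.
Variable R : realType.

Lemma dominated_small (f_ : nat -> R -> R) (g : R -> R) (e : R) :
  (forall n, measurable_fun setT (f_ n)) -> intg g ->
  (forall n x, `|f_ n x| <= g x) -> (forall x, f_ n x @[n --> \oo] --> 0) ->
  0 < e -> exists n, `|RI (f_ n)| < e.
Proof.
move=> mf ig fg f0 e0.
have fi n : intg (f_ n) by exact: intg_dom ig.
have [] := @dominated_convergence _ _ R (@leb R) setT measurableT
  (fun n x => (f_ n x)%:E) (fun=> 0%E) (fun x => (g x)%:E).
- by move=> n; apply/measurable_EFinP; exact: mf.
- exact: measurable_cst.
- apply: aeW => x _; apply/fine_cvgP; split; first by near=> n.
  exact: f0.
- exact: ig.
- by apply: aeW => x n _; rewrite lee_fin.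
move=> _ _; rewrite integral0 => /fine_cvgP[_] /cvgrPdist_lt /(_ e e0)[N _ hN].
exists N; have := hN N (leqnn N); rewrite /= sub0r normrN.
by [].
Unshelve. all: by end_near. Qed.

Lemma lipschitz_of_derive (f df : R -> R) (M : R) :
  (forall x : R, is_derive x (1 : R) f (df x)) -> (forall x, `|df x| <= M) ->
  forall a b, `|f a - f b| <= M * `|a - b|.
Proof.
move=> fd dM; have H a b : a < b -> `|f b - f a| <= M * `|b - a|.
  move=> ab; have [|c _ ->] := @MVT R f df a b ab.
    apply: continuous_subspaceT; apply: derivable_continuous => x.
    by exists (df x).
  by rewrite normrM ler_wpM2r.
move=> a b; have [ab|ba|->] := ltgtP a b.
- by rewrite distrC [`|a - b|]distrC H.
- exact: H.
- by rewrite !subrr normr0 mulr0.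
Qed.

Lemma cos_lipschitz (a b : R) : `|cos a - cos b| <= `|a - b|.
Proof.
rewrite -[leRHS]mul1r; apply: (@lipschitz_of_derive _ (fun x => - sin x)).
by move=> x; rewrite normrN ler_norml sin_le1 sin_geN1.
Qed.

Lemma sin_lipschitz (a b : R) : `|sin a - sin b| <= `|a - b|.
Proof.
rewrite -[leRHS]mul1r; apply: (@lipschitz_of_derive _ cos).
by move=> x; rewrite ler_norml cos_le1 cos_geN1.
Qed.

Lemma ee_lipschitz (a b : R) : normc (ee a - ee b) <= 4 * pi * `|a - b|.
Proof.
apply: le_trans (le_normc_ReIm _) _; rewrite cReD cReN cImD cImN /=.
have := cos_lipschitz (2 * pi * a) (2 * pi * b).
have := sin_lipschitz (2 * pi * a) (2 * pi * b).
rewrite -mulrBr normrM ger0_norm ?mulr_ge0// ?pi_ge0//.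
by move: (pi) `|_ - _| `|_ - _| `|a - b| => *; lra.
Qed.

Lemma ee_dist2 (a b : R) : normc (ee a - ee b) <= 2.
Proof.
by apply: le_trans (le_normcB _ _) _; rewrite !normc_ee.
Qed.

Lemma ft_continuous (k : R -> R[i]) : cL1 k -> forall eta : R, 0 < eta ->
  exists2 d : R, 0 < d & forall v w, `|v - w| < d -> normc (ft k v - ft k w) <= eta.
Proof.
move=> ki eta eta0; have nk := cL1_normc ki.
(* This bounds the change of the integrand over a step of length [1 / (n + 1)]. The Lipschitz bound
   gives the limit 0; the cap 2 gives domination by [2 * normc (k x)], since [x * k x] need not be
   integrable. *)
pose f_ (n : nat) (x : R) : R := normc (k x) * Num.min 2 (4 * pi * `|x| * n.+1%:R^-1).
have m0 n (x : R) : 0 <= Num.min 2 (4 * pi * `|x| * n.+1%:R^-1) :> R.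
  by rewrite le_min ler0n/= !mulr_ge0// pi_ge0.
have mf n : measurable_fun setT (f_ n).
  apply: measurable_funM; first exact: measurable_normc (cL1_cmeas ki).
  apply: measurable_minr => //; apply: measurable_funM => //.
  by apply: measurable_funM => //; exact: measurableT_comp.
have f0 n x : 0 <= f_ n x by rewrite mulr_ge0// normc_ge0.
have fg n x : `|f_ n x| <= 2 * normc (k x).
  by rewrite ger0_norm// /f_ mulrC ler_wpM2r ?normc_ge0// ge_min lexx.
have [|n] := dominated_small mf (intgZ 2 nk) fg _ eta0.
  move=> x; rewrite /f_.
  have h : (4 * pi * `|x| * normc (k x)) * n.+1%:R^-1 @[n --> \oo] --> (0 : R).
    rewrite -[X in _ --> X](mulr0 (4 * pi * `|x| * normc (k x))).
    by apply: cvgM; [exact: cvg_cst|exact: cvg_harmonic].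
  apply: (squeeze_cvgr _ (cvg_cst (0 : R)) h).
  near=> m; rewrite f0 /= /f_ [leRHS]mulrAC [leLHS]mulrC ler_wpM2r ?normc_ge0//.
  by rewrite ge_min lexx orbT.
rewrite ger0_norm ?RI_ge0// => hn.
exists n.+1%:R^-1 => [|v w vw]; first by rewrite invr_gt0.
have iv := cL1_ft v ki; have iw := cL1_ft w ki.
rewrite /ft -CIB//; apply: le_trans (ltW hn).
apply: CI_le; [exact: cL1B|exact: intg_dom (intgZ 2 nk)|].
move=> x; rewrite -mulrBr normcM ler_wpM2l ?normc_ge0// le_min ee_dist2/=.
apply: le_trans (ee_lipschitz _ _) _; rewrite -mulrBr normrM mulrA.
by rewrite ler_wpM2l ?mulr_ge0 ?pi_ge0// ltW.
Unshelve. all: by end_near. Qed.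

(** Only [x] is confined to the segment; [y] may lie outside, as a translate [t + u] does. Each
    point gets a radius from continuity at [e / 2], halved to leave room for [y], and compactness
    makes the radius uniform. *)
Lemma heine_cantor (g : R -> R) (a b e : R) : continuous g -> 0 < e ->
  exists2 d, 0 < d & forall x y, a <= x <= b -> `|y - x| < d -> `|g y - g x| < e.
Proof.
move=> cg e0.
have := @segment_compact R a b; rewrite compact_near_coveringP.
move=> /(_ R (0 : R)^'+ (fun d x => forall y, `|y - x| < d -> `|g y - g x| < e) _).
have H : forall x, `[a, b]%classic x -> \forall x' \near x & d \near (0 : R)^'+,
    forall y, `|y - x'| < d -> `|g y - g x'| < e.
  move=> x _.
  have /cvgrPdist_lt /(_ (e / 2)) := cg x.
  rewrite divr_gt0// => /(_ isT) /nbhs_ballP[r /= r0 hr].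
  have r2 : 0 < r / 2 by rewrite divr_gt0.
  near=> x' d => y yx.
  have x'x : `|x - x'| < r / 2 by near: x'; exact: nbhsx_ballx.
  have dr : d < r / 2 by near: d; exact: nbhs_right_lt.
  have h1 : `|g x - g x'| < e / 2.
    by apply: hr; rewrite /ball /=; apply: lt_trans x'x _; rewrite ltr_pdivrMr// ltr_pMr// ltr1n.
  have h2 : `|g x - g y| < e / 2.
    apply: hr; rewrite /ball /=; have -> : x - y = (x - x') - (y - x') by ring.
    apply: le_lt_trans (ler_normB _ _) _; rewrite [ltRHS](splitr r).
    by apply: ltrD => //; exact: lt_trans dr.
  have -> : g y - g x' = (g x - g x') - (g x - g y) by ring.
  by apply: le_lt_trans (ler_normB _ _) _; rewrite [ltRHS](splitr e) ltrD.
move=> /(_ H) [d /= d0 hd].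
exists (d / 2); first by rewrite divr_gt0.
move=> x y xab; apply: (hd (d / 2)) => //=.
- by rewrite sub0r normrN ger0_norm ?divr_ge0 ?(ltW d0)// ltr_pdivrMr// ltr_pMr// ltr1n.
- by rewrite divr_gt0.
Unshelve. all: by end_near. Qed.

End Dominated.

Section Translation.
Variable R : realType.

Definition box (r : R) : set R := `[- r, r]%classic.

Lemma boxP (r x : R) : box r x <-> `|x| <= r.
Proof. by rewrite /box /= in_itv /= ler_norml. Qed.

Lemma intg_box (r : R) : intg (\1_(box r)).
Proof. exact: integrable_indic_itv. Qed.

(* Only this case is needed: a square-integrable function is a limit of its
   truncations, and [(x - y) ^+ 2 <= 2 * N * `|x - y|] when [x] and [y] are
   bounded by [N]. *)
Lemma translation_L1_bounded (b : R -> R) (N : R) : measurable_fun setT b ->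
  0 < N -> (forall x, `|b x| <= N) -> (forall x, N < `|x| -> b x = 0) ->
  forall e : R, 0 < e -> exists2 d : R, 0 < d & forall u, `|u| < d ->
    RI (fun t => `|b (t + u) - b t|) <= e.
Proof.
move=> mb N0 bN b0 e e0.
(* With [|u| < 1], either [|t| <= N + 1] and both [t] and [t + u] lie in [E], or both values of [b]
   vanish. The approximation [g] of [b] is controlled on [E] only. *)
pose E := box (N + 2).
have mE : measurable (E : set (measurableTypeR R)) by exact: measurable_itv.
have Efin : (lebesgue_measure E < +oo)%E.
  by rewrite /E /box lebesgue_measure_itv/=; case: ifP => _; rewrite -?EFinB ltry.
have bi : intg b.
  apply: intg_dom mb _ (intgZ N (intg_box N)) => x.
  have [xN|Nx] := leP `|x| N; last by rewrite b0// normr0 mulr_ge0 ?(ltW N0).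
  by rewrite indicE mem_set ?mulr1//; exact/boxP.
have bE : lebesgue_measure.-integrable E (EFin \o b).
  exact: integrableS bi.
have [g_ [cg ig hg]] := approximation_continuous_integrable mE Efin bE.
have [n hn] : exists n, RI (fun x => \1_E x * `|b x - g_ n x|) < e / 4.
  have e4 : 0 < e / 4 by rewrite divr_gt0.
  move: hg => /fine_cvgP[_] /cvgrPdist_lt /(_ _ e4)[n _ hn].
  exists n; have := hn n (leqnn n); rewrite /= sub0r normrN.
  move=> H; apply: le_lt_trans H; apply: le_trans (ler_norm _).
  rewrite le_eqVlt; apply/orP; left; apply/eqP.
  rewrite /Rintegral; congr fine.
  rewrite [RHS]integral_mkcond; apply: eq_integral => x _.
  by rewrite patchE indicE; case: ifP => _; rewrite ?mul1r// mul0r.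
pose g := g_ n; pose dd x := \1_E x * `|b x - g x|.
have ddi : intg dd.
  have := integrableB mE bE (ig n) => /integrable_abse.
  rewrite integrable_mkcond//; apply: eq_integrable => // x _ /=.
  by rewrite patchE /dd indicE; case: ifP => _; rewrite ?mul1r// mul0r.
(* Chosen so that [e'] times the length of [box (N + 1)] is at most [e / 4]. The two approximation
   errors cost [e / 4] each. *)
pose e' := e / 4 / (RI (\1_(box (N + 1))) + 1).
have I0 : 0 < RI (\1_(box (N + 1))) + 1 by rewrite ltr_wpDl// RI_ge0.
have e'0 : 0 < e' by rewrite !divr_gt0.
have [d d0 hd] := heine_cantor (- (N + 1)) (N + 1) (cg n) e'0.
exists (Num.min d 1) => [|u]; first by rewrite lt_min d0 ltr01.
rewrite lt_min => /andP[ud u1].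
have i1 := intg_shift u ddi.
have i3 := intgZ e' (intg_box (N + 1)).
apply: (@le_trans _ _ (RI (fun t => dd (t + u) + dd t + e' * \1_(box (N + 1)) t))).
  apply: le_RI.
  - by apply: intg_norm; apply: intgB => //; exact: intg_shift.
  - by apply: intgD => //; exact: intgD.
  - move=> t; have dd0 x : 0 <= dd x by rewrite mulr_ge0.
    have [tN|Nt] := leP `|t| (N + 1).
      have tE : E t by apply/boxP; apply: le_trans tN _; rewrite lerD2l ler1n.
      have tuE : E (t + u).
        apply/boxP; apply: le_trans (ler_normD _ _) _.
        by rewrite (_ : N + 2 = (N + 1) + 1); [apply: lerD => //; exact: ltW|ring].
      rewrite /dd !indicE (mem_set tE) (mem_set tuE) !mul1r.
      rewrite mem_set ?mulr1; last exact/boxP.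
      have -> : b (t + u) - b t = (b (t + u) - g (t + u)) - (b t - g t) + (g (t + u) - g t) by ring.
      apply: le_trans (ler_normD _ _) _; apply: lerD.
        exact: ler_normB.
      apply/ltW/hd; first by rewrite -ler_norml.
      by rewrite addrC addKr.
    rewrite b0; last first.
      have := lerB_dist t (- u); rewrite opprK normrN; lra.
    rewrite b0; last by apply: lt_trans Nt; rewrite ltrDl.
    by rewrite subrr normr0 !addr_ge0// mulr_ge0// ltW.
rewrite (RID (intgD i1 ddi) i3) (RID i1 ddi) (RI_shift u ddi) (RIZ _ (intg_box _)).
have : e' * RI \1_(box (N + 1)) <= e / 4.
  rewrite /e' -mulrA ler_piMr ?divr_ge0 ?(ltW e0)//.
  by rewrite mulrC ler_pdivrMr// mul1r lerDl.
have : RI dd < e / 4 by exact: hn.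
by move: (RI dd) (e' * _) => *; lra.
Qed.

Lemma measurable_truncation (b : R -> R) (n : nat) : measurable_fun setT b ->
  measurable_fun setT (fun x => b x * \1_[set x | (`|b x| <= n%:R) && (`|x| <= n%:R)] x).
Proof.
move=> mb; apply: measurable_funM => //; apply: measurable_indic.
have -> : [set x | (`|b x| <= n%:R) && (`|x| <= n%:R)] =
    (fun x => `|b x|) @^-1` `]-oo, n%:R] `&` ((fun x => `|x|) @^-1` `]-oo, n%:R]).
  by apply/seteqP; split => x /=; rewrite !in_itv/= => /andP.
apply: measurableI; rewrite -[X in measurable X]setTI.
  have mnb : measurable_fun setT (fun x => `|b x|) by exact: measurableT_comp.
  by apply: mnb => //; exact: measurable_itv.
have mn : measurable_fun setT (fun x : R => `|x|) by exact: measurableT_comp.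
by apply: mn => //; exact: measurable_itv.
Qed.

Lemma translation_L2_real (b : R -> R) : measurable_fun setT b ->
  intg (fun x => b x ^+ 2) ->
  forall e : R, 0 < e -> exists2 d : R, 0 < d & forall u, `|u| < d ->
    RI (fun t => (b (t + u) - b t) ^+ 2) <= e.
Proof.
move=> mb b2 e e0.
pose A (n : nat) := [set x | (`|b x| <= n%:R) && (`|x| <= n%:R)].
pose bn n x := b x * \1_(A n) x.
have mbn n : measurable_fun setT (bn n) by exact: measurable_truncation.
have bnE n x : (bn n x = b x /\ `|b x| <= n%:R /\ `|x| <= n%:R) \/
    (bn n x = 0 /\ ~ (`|b x| <= n%:R /\ `|x| <= n%:R)).
  rewrite /bn indicE; case: (boolP (x \in A n)) => [|/negP]; rewrite inE => hx.
    by left; rewrite mulr1; move/andP : hx.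
  by right; rewrite mulr0; split => // h; apply: hx; apply/andP.
pose r n x := (b x - bn n x) ^+ 2.
have r2 n x : `|r n x| <= b x ^+ 2.
  rewrite ger0_norm ?sqr_ge0// /r.
  by have [[-> _]|[-> _]] := bnE n x; rewrite ?subrr ?subr0// expr0n sqr_ge0.
have mr n : measurable_fun setT (r n).
  by apply: measurable_funX; apply: measurable_funB.
have e6 : 0 < e / 12 by rewrite divr_gt0.
have [|n hn] := dominated_small mr b2 r2 _ e6.
  move=> x; apply/cvgrPdist_lt => /= eps eps0; near=> n.
  rewrite sub0r normrN /r.
  have [[-> _]|[_ hc]] := bnE n x; first by rewrite subrr expr0n normr0.
  exfalso; apply: hc; split.
    by near: n; exact: nbhs_infty_ger.
  by near: n; exact: nbhs_infty_ger.
have rni : intg (r n) by exact: intg_dom b2.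
have RIr : RI (r n) < e / 12 by rewrite (le_lt_trans (ler_norm _) hn).
(* The successor keeps [N] positive even when [n] is 0. *)
pose N : R := n.+1%:R.
have N0 : 0 < N by rewrite ltr0n.
have nN : n%:R <= N by rewrite ler_nat.
have bnN x : `|bn n x| <= N.
  have [[-> [h _]]|[-> _]] := bnE n x; first exact: le_trans nN.
  by rewrite normr0 ltW.
have bnz x : N < `|x| -> bn n x = 0.
  move=> Nx; have [[_ [_ h]]|[-> //]] := bnE n x.
  by have := lt_le_trans Nx (le_trans h nN); rewrite ltxx.
have eN : 0 < e / (12 * N) by rewrite divr_gt0// mulr_gt0.
have [d d0 hd] := translation_L1_bounded (mbn n) N0 bnN bnz eN.
exists d => // u ud; have := hd u ud => {}hd.
have bni : intg (bn n).
  apply: intg_dom (mbn n) _ (intgZ N (intg_box N)) => x.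
  have [xN|Nx] := leP `|x| N; last by rewrite bnz// normr0 mulr_ge0 ?(ltW N0).
  by rewrite indicE mem_set ?mulr1//; exact/boxP.
have i1 := intg_shift u rni.
have i2 := intg_norm (intgB (intg_shift u bni) bni).
(* The square of a sum of three terms is at most three times the sum of their squares, whence the
   factor 3. The integral of [S] is at most [e / 12 + e / 12 + e / 6]. *)
pose S t := r n (t + u) + r n t + 2 * N * `|bn n (t + u) - bn n t|.
have iS : intg S by apply: intgD; [exact: intgD|exact: intgZ].
have SI : RI S <= e / 3.
  rewrite /S (RID (intgD i1 rni) (intgZ _ i2)) (RID i1 rni) (RI_shift u rni) (RIZ _ i2).
  have : 2 * N * RI (fun x => `|bn n (x + u) - bn n x|) <= 2 * N * (e / (12 * N)).
    by rewrite ler_pM2l// mulr_gt0.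
  have -> : 2 * N * (e / (12 * N)) = e / 6 by field; rewrite gt_eqF.
  by move: (_ * RI _) => ?; lra.
have S3 t : (b (t + u) - b t) ^+ 2 <= 3 * S t.
  have h1 := bnN t; have h2 := bnN (t + u).
  have h3 : (bn n (t + u) - bn n t) ^+ 2 <= 2 * N * `|bn n (t + u) - bn n t|.
    rewrite -[leLHS]real_normK ?num_real// expr2 ler_wpM2r//.
    by apply: le_trans (ler_normB _ _) _; rewrite mulr_natl mulr2n lerD.
  rewrite /S /r; move: h3; move: (2 * N * _) => z.
  move: (b (t + u)) (b t) (bn n (t + u)) (bn n t) => x y x' y' h3.
  have := sqr_ge0 ((x - x') + (y - y')); have := sqr_ge0 ((x - x') - (x' - y')).
  have := sqr_ge0 ((x' - y') + (y - y')).
  by rewrite !expr2 in h3 *; lra.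
apply: (@le_trans _ _ (RI (fun t => 3 * S t))).
  apply: le_RI => //; last exact: intgZ.
  apply: intg_dom (intgZ 3 iS).
    apply: measurable_funX; apply: measurable_funB => //.
    exact: (measurableT_comp mb (measurable_shift u)).
  by move=> t; rewrite ger0_norm ?sqr_ge0.
by rewrite RIZ//; lra.
Unshelve. all: by end_near. Qed.

End Translation.

(** * Autocorrelations *)

Section Autocorrelation.
Variable R : realType.
Implicit Types h k : R -> R[i].
Notation RR := (measurableTypeR R * measurableTypeR R)%type.

Definition cL2 h := cmeas h /\ intg (fun x => normsq (h x)).

Lemma cL2_mul h k : cL2 h -> cL2 k -> cL1 (fun x => h x * k x).
Proof.
move=> [mh h2] [mk k2]; apply: cL1_dom (intgD h2 k2); first exact: cmeasM.
by move=> x; exact: normc_le_normsq.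
Qed.

Lemma cmeas_shift h (u : R) : cmeas h -> cmeas (fun x : R => h (x + u)).
Proof. by move=> mh; exact: cmeas_comp mh (measurable_shift u). Qed.

Lemma cL2_shift h u : cL2 h -> cL2 (fun x => h (x + u)).
Proof.
by move=> [mh h2]; split; [exact: cmeas_shift|exact: (intg_shift u h2)].
Qed.

Lemma normsqJ (z : R[i]) : normsq (conjc z) = normsq z.
Proof. by rewrite -!normc_sq cnormJ. Qed.

Lemma cL2J h : cL2 h -> cL2 (fun x => conjc (h x)).
Proof.
by move=> [mh h2]; split; [exact: cmeasJ|under eq_fun do rewrite normsqJ].
Qed.

Lemma cL2Mb h k (M : R) : cL2 h -> cmeas k -> (forall x, normc (k x) <= M) ->
  cL2 (fun x => k x * h x).
Proof.
move=> [mh h2] mk kM; split; first exact: cmeasM.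
apply: intg_dom (intgZ (M ^+ 2) h2); first by apply: measurable_normsq; exact: cmeasM.
move=> x; rewrite ger0_norm ?normsq_ge0// normsqM ler_wpM2r ?normsq_ge0//.
rewrite -normc_sq lerXn2r ?nnegrE ?normc_ge0//.
exact: le_trans (normc_ge0 _) (kM x).
Qed.

Lemma cL2_Re h : cL2 h -> intg (fun x => Re (h x) ^+ 2).
Proof.
move=> [[m1 m2] h2]; apply: intg_dom h2; first exact: measurable_funX.
by move=> x; rewrite ger0_norm ?sqr_ge0// /normsq lerDl sqr_ge0.
Qed.

Lemma cL2_Im h : cL2 h -> intg (fun x => Im (h x) ^+ 2).
Proof.
move=> [[m1 m2] h2]; apply: intg_dom h2; first exact: measurable_funX.
by move=> x; rewrite ger0_norm ?sqr_ge0// /normsq lerDr sqr_ge0.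
Qed.

Lemma normsqB_le (z w : R[i]) : normsq (z - w) <= 2 * normsq z + 2 * normsq w.
Proof.
rewrite /normsq cReD cReN cImD cImN.
have := sqr_ge0 (Re z + Re w); have := sqr_ge0 (Im z + Im w).
by rewrite !expr2; nra.
Qed.

Lemma cL2B h k : cL2 h -> cL2 k -> cL2 (fun x => h x - k x).
Proof.
move=> [mh h2] [mk k2]; split; first exact: cmeasB.
apply: intg_dom (intgD (intgZ 2 h2) (intgZ 2 k2)).
  by apply: measurable_normsq; exact: cmeasB.
by move=> x; rewrite ger0_norm ?normsq_ge0// normsqB_le.
Qed.

Lemma translation_L2 h : cL2 h ->
  forall e : R, 0 < e -> exists2 d : R, 0 < d & forall u, `|u| < d ->
    RI (fun t => normsq (h (t + u) - h t)) <= e.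
Proof.
move=> hi e e0; have [[m1 m2] h2] := hi.
have e2 : 0 < e / 2 by rewrite divr_gt0.
have [d1 d10 hd1] := translation_L2_real m1 (cL2_Re hi) e2.
have [d2 d20 hd2] := translation_L2_real m2 (cL2_Im hi) e2.
exists (Num.min d1 d2) => [|u]; first by rewrite lt_min d10.
rewrite lt_min => /andP[ud1 ud2].
have di := cL2B (cL2_shift u hi) hi.
have E t : normsq (h (t + u) - h t) =
    (Re (h (t + u)) - Re (h t)) ^+ 2 + (Im (h (t + u)) - Im (h t)) ^+ 2.
  by rewrite /normsq cReD cReN cImD cImN.
have i1 : intg (fun t => (Re (h (t + u)) - Re (h t)) ^+ 2).
  have := cL2_Re di.
  by under [X in intg X]eq_fun do rewrite cReD cReN.
have i2 : intg (fun t => (Im (h (t + u)) - Im (h t)) ^+ 2).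
  have := cL2_Im di.
  by under [X in intg X]eq_fun do rewrite cImD cImN.
rewrite (funext E) RID// [leRHS](splitr e).
by apply: lerD; [exact: hd1|exact: hd2].
Qed.

(** The weighted inequality [a b <= s / 2 * a ^+ 2 + b ^+ 2 / (2 s)] stands in for Cauchy-Schwarz.
    With [s = (K + 1) / eta] the second term integrates to at most [eta / 2], and [translation_L2]
    at level [eta / s] does the same for the first; [K + 1] rather than [K] keeps [s] positive. *)
Lemma translation_mul h k : cL2 h -> cL2 k ->
  forall eta : R, 0 < eta -> exists2 d : R, 0 < d & forall u, `|u| < d ->
    RI (fun t => normc (h (t + u) - h t) * normc (k t)) <= eta.
Proof.
move=> hi ki eta eta0; have [mk k2] := ki.
pose K := RI (fun x => normsq (k x)).
have K0 : 0 <= K by apply: RI_ge0 => x; exact: normsq_ge0.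
have K1 : 0 < K + 1 by rewrite ltr_wpDl.
pose s := (K + 1) / eta.
have s0 : 0 < s by rewrite divr_gt0.
have es : 0 < eta / s by rewrite divr_gt0.
have [d d0 hd] := translation_L2 hi es.
exists d => // u ud; have [md d2] := cL2B (cL2_shift u hi) hi.
have i1 := intgZ (s / 2) d2; have i2 := intgZ ((2 * s)^-1) k2.
apply: (@le_trans _ _ (RI (fun t => s / 2 * normsq (h (t + u) - h t) + (2 * s)^-1 * normsq (k t)))).
  apply: le_RI.
  - have := cL1_normc (cL2_mul (cL2B (cL2_shift u hi) hi) ki).
    by apply: eq_integrable => // x _ /=; rewrite normcM.
  - exact: intgD.
  - move=> t; rewrite -!normc_sq; move: (normc _) (normc (k t)) => a b.
    rewrite -subr_ge0.
    have -> : s / 2 * a ^+ 2 + (2 * s)^-1 * b ^+ 2 - a * b = (2 * s)^-1 * (s * a - b) ^+ 2.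
      by field; rewrite gt_eqF.
    by rewrite mulr_ge0 ?sqr_ge0// invr_ge0 mulr_ge0// ltW.
rewrite RID// RIZ// RIZ// -/K [leRHS](splitr eta); apply: lerD.
  apply: (@le_trans _ _ (s / 2 * (eta / s))).
    by rewrite ler_pM2l ?divr_gt0//; exact: hd.
  by rewrite le_eqVlt; apply/orP; left; apply/eqP; field; rewrite gt_eqF.
have -> : (2 * s)^-1 * K = eta / 2 * (K / (K + 1)).
  by rewrite /s; field; rewrite !gt_eqF.
by rewrite ler_piMr ?divr_ge0 ?(ltW eta0)// ler_pdivrMr// mul1r lerDl.
Qed.

Definition acorr h (u : R) : R[i] := CI (fun t => h (t + u) * conjc (h t)).

Lemma acorr_continuous h : cL2 h -> forall u (eta : R), 0 < eta ->
  exists2 d : R, 0 < d & forall x, `|x| < d -> normc (acorr h (x + u) - acorr h u) <= eta.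
Proof.
move=> hi u eta eta0; have hu := cL2_shift u hi.
have [d d0 hd] := translation_mul hu hi eta0.
exists d => // x xd; have hJ := cL2J hi.
have i1 := cL2_mul (cL2_shift (x + u) hi) hJ; have i2 := cL2_mul hu hJ.
rewrite /acorr -CIB//; apply: le_trans (normc_CI (cL1B i1 i2)) _.
apply: le_trans (hd x xd); rewrite le_eqVlt; apply/orP; left; apply/eqP.
congr (Rintegral _ _ _); apply/funext => t.
by rewrite -mulrBl normcM cnormJ addrA.
Qed.

(** The Wiener-Khinchin identity, by Fubini after splitting [ee (u * v)] as [ee ((u + t) * v)] times
    the conjugate of [ee (t * v)]. The L^1 hypothesis gives the domination; the L^2 hypothesis makes
    the slice in [t] integrable for every [u]. *)
Lemma ft_acorr h : cL1 h -> cL2 h -> cL1 (acorr h) /\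
  forall v, ft (acorr h) v = ft h v * conjc (ft h v).
Proof.
move=> h1 h2; have mh := cL1_cmeas h1.
have key v : cL1 (fun u => acorr h u * ee (u * v)) /\ ft (acorr h) v = ft h v * conjc (ft h v).
  pose H (z : RR) := conjc (h z.1) * (h (z.2 + z.1) * ee (z.2 * v)).
  have mH : cmeas H.
    apply: cmeasM; first exact: cmeasJ (cmeas_comp mh (@measurable_fstR R)).
    apply: cmeasM.
      apply: (cmeas_comp mh); apply: measurable_funD.
        exact: measurable_sndR.
      exact: measurable_fstR.
    by apply: cmeas_ee; apply: measurable_funM => //; exact: measurable_sndR.
  have hv t : cL1 (fun u => h (u + t) * ee (u * v)).
    by apply: cL1_ft; exact: cL1_shift.
  have ip := intgZ (RI (fun x => normc (h x))) (cL1_normc h1).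
  have [|||_ r2 r3] := CFubini mH ip.
  - by move=> t; rewrite /H /=; exact: cL1Zl.
  - move=> t; rewrite /H /= -(RI_shift t (cL1_normc h1)) mulrC.
    rewrite -RIZ; last exact: (intg_shift t (cL1_normc h1)).
    apply: le_RI; [by apply: cL1_normc; exact: cL1Zl| |].
      by apply: intgZ; exact: (intg_shift t (cL1_normc h1)).
    by move=> u; rewrite !normcM cnormJ normc_ee mulr1.
  - move=> u; rewrite /H /=.
    have -> : (fun t => conjc (h t) * (h (u + t) * ee (u * v))) =
        (fun t => ee (u * v) * (h (t + u) * conjc (h t))).
      by apply/funext => t; rewrite [u + t]addrC; ring.
    by apply: cL1Zl; apply: cL2_mul; [exact: cL2_shift|exact: cL2J].
  have E (u : R) : acorr h u * ee (u * v) = CI (fun t => H (t, u)).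
    rewrite /acorr -CIZr; last by apply: cL2_mul; [exact: cL2_shift|exact: cL2J].
    by apply: eq_CI => t; rewrite /H /= [u + t]addrC; ring.
  split; first by rewrite (funext E); exact: r2.
  transitivity (CI (fun u : R => CI (fun t : R => H (t, u)))).
    by apply: eq_CI => u; exact: E.
  rewrite -r3.
  have E' (t : R) : CI (fun u => H (t, u)) = ft h v * conjc (h t * ee (t * v)).
    transitivity (CI (fun u : R => conjc (h t) * (h (u + t) * ee (u * v)))); first by [].
    rewrite (CIZl (conjc (h t)) (hv t)).
    have -> : CI (fun u => h (u + t) * ee (u * v)) = ee (- (t * v)) * ft h v := ft_shift t v h1.
    by rewrite eeN conjcM; ring.
  by rewrite (eq_CI E') (CIZl _ (cL1J (cL1_ft v h1))) (CIJ (cL1_ft v h1)).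
split; last by move=> v; case: (key v).
(* At frequency 0 the exponential is 1, so integrability of the autocorrelation itself can be read
   off. *)
have [k0 _] := key 0.
by move: k0; under [X in cL1 X]eq_fun do rewrite mulr0 ee0 mulr1.
Qed.

(** The two autocorrelations have the same transform, the squared modulus. Both are continuous
    because [h] and [k] are in L^2, so [ft_eq0] gives equality at every [u]. *)
Lemma acorr_unique h k : cL1 h -> cL2 h -> cL1 k -> cL2 k ->
  (forall v, normc (ft h v) = normc (ft k v)) -> forall u, acorr h u = acorr k u.
Proof.
move=> h1 h2 k1 k2 hk u.
have [ha hf] := ft_acorr h1 h2; have [ka kf] := ft_acorr k1 k2.
apply/eqP; rewrite -subr_eq0; apply/eqP.
apply: (@ft_eq0 _ (fun u => acorr h u - acorr k u)).
- exact: cL1B.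
- move=> {}u eta eta0; have e2 : 0 < eta / 2 by rewrite divr_gt0.
  have [d1 d10 hd1] := acorr_continuous h2 u e2.
  have [d2 d20 hd2] := acorr_continuous k2 u e2.
  exists (Num.min d1 d2) => [|x]; first by rewrite lt_min d10.
  rewrite lt_min => /andP[xd1 xd2].
  have -> : acorr h (x + u) - acorr k (x + u) - (acorr h u - acorr k u) =
      (acorr h (x + u) - acorr h u) - (acorr k (x + u) - acorr k u) by ring.
  apply: le_trans (le_normcB _ _) _; rewrite [leRHS](splitr eta).
  by apply: lerD; [exact: hd1|exact: hd2].
- move=> v; transitivity (ft (acorr h) v - ft (acorr k) v).
    rewrite /ft -CIB; [|exact: cL1_ft|exact: cL1_ft].
    by apply: eq_CI => x; rewrite mulrBl.
  by rewrite hf kf !conjcMz -!normc_sq hk subrr.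
Qed.

(** The transform in [x] of this correlation factors as the product in the conclusion; the
    reflection [- w] comes from the plus sign in [psi (t + x)]. Boundedness of [D] makes the
    integrand integrable in [t] for every [x]. *)
Lemma conv_eq0 (D psi : R -> R[i]) (M : R) : cL1 D -> (forall t, normc (D t) <= M) ->
  cL1 psi -> (forall x, CI (fun t => D t * psi (t + x)) = 0) ->
  forall w, ft D (- w) * ft psi w = 0.
Proof.
move=> Di DM pi0 C0 w; have mD := cL1_cmeas Di; have mp := cL1_cmeas pi0.
pose H (z : RR) := D z.1 * (psi (z.2 + z.1) * ee (z.2 * w)).
have mH : cmeas H.
  apply: cmeasM; first exact: (cmeas_comp mD (@measurable_fstR R)).
  apply: cmeasM.
    apply: (cmeas_comp mp); apply: measurable_funD.
      exact: measurable_sndR.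
    exact: measurable_fstR.
  by apply: cmeas_ee; apply: measurable_funM => //; exact: measurable_sndR.
have hv t : cL1 (fun u => psi (u + t) * ee (u * w)).
  by apply: cL1_ft; exact: cL1_shift.
have ip := intgZ (RI (fun x => normc (psi x))) (cL1_normc Di).
have Dpsi x : cL1 (fun t => D t * psi (t + x)).
  under [X in cL1 X]eq_fun do rewrite mulrC.
  by apply: cL1Mb DM => //; exact: cL1_shift.
have [|||_ _ r3] := CFubini mH ip.
- by move=> t; rewrite /H /=; exact: cL1Zl.
- move=> t; rewrite /H /= -(RI_shift t (cL1_normc pi0)) mulrC.
  rewrite -RIZ; last exact: (intg_shift t (cL1_normc pi0)).
  apply: le_RI; [by apply: cL1_normc; exact: cL1Zl| |].
    by apply: intgZ; exact: (intg_shift t (cL1_normc pi0)).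
  by move=> u; rewrite !normcM normc_ee mulr1.
- move=> x; rewrite /H /=.
  have -> : (fun t => D t * (psi (x + t) * ee (x * w))) =
      (fun t => ee (x * w) * (D t * psi (t + x))).
    by apply/funext => t; rewrite [x + t]addrC; ring.
  exact: cL1Zl.
have HE (x t : R) : H (t, x) = ee (x * w) * (D t * psi (t + x)).
  by rewrite /H /= [x + t]addrC; ring.
have E (x : R) : CI (fun t : R => H (t, x)) = 0.
  by rewrite (eq_CI (HE x)) (CIZl _ (Dpsi x)) C0 mulr0.
have E' (t : R) : CI (fun x => H (t, x)) = D t * ee (t * - w) * ft psi w.
  transitivity (CI (fun u : R => D t * (psi (u + t) * ee (u * w)))); first by [].
  rewrite (CIZl (D t) (hv t)).
  have -> : CI (fun u => psi (u + t) * ee (u * w)) = ee (- (t * w)) * ft psi w := ft_shift t w pi0.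
  by rewrite mulrN mulrA.
rewrite {1}/ft -CIZr; last exact: cL1_ft.
by rewrite -(funext E') r3 (funext E) CI0.
Qed.

End Autocorrelation.

(** * Band-limited functions *)

Section BandLimited.
Variable R : realType.
Implicit Types F G a : R -> R[i].

Lemma RI_eq0_continuous (p : R -> R) (t0 : R) : intg p -> (forall x, 0 <= p x) ->
  RI p = 0 ->
  (forall eta : R, 0 < eta -> exists2 d : R, 0 < d &
    forall x, `|x - t0| < d -> `|p x - p t0| <= eta) ->
  p t0 = 0.
Proof.
move=> ip p0 I0 cp; apply/eqP; apply: contraT => n0.
have a0 : 0 < p t0 by rewrite lt_neqAle eq_sym n0 p0.
have [|d d0 hd] := cp (p t0 / 2); first by rewrite divr_gt0.
pose J : set R := `[(t0 - d / 2), (t0 + d / 2)]%classic.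
have iJ : intg (\1_J) by exact: integrable_indic_itv.
have d2 : 0 < d / 2 by rewrite divr_gt0.
have IJ : RI (\1_J) = d.
  have EJ : lebesgue_measure J = d%:E.
    rewrite lebesgue_measure_itv/= lte_fin ifT; last by lra.
    by rewrite -EFinB; congr EFin; field.
  rewrite /Rintegral integral_indic//; last exact: measurable_itv.
  by rewrite setIT; exact: (congr1 fine EJ).
have : p t0 / 2 * d <= 0.
  rewrite -I0 -IJ -(RIZ _ iJ); apply: le_RI => //; first exact: intgZ.
  move=> x; rewrite indicE; case: (boolP (x \in J)) => [|_]; last by rewrite mulr0.
  rewrite inE /J /= in_itv/= mulr1 => xJ.
  have : `|x - t0| < d by rewrite ltr_norml; lra.
  by move=> /hd; rewrite ler_norml => /andP[]; lra.
have : 0 < p t0 / 2 * d by rewrite mulr_gt0// divr_gt0.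
by move=> h1 h2; have := lt_le_trans h1 h2; rewrite ltxx.
Qed.

Lemma ft_conj_modulate a (xi eta : R) : cL1 a ->
  ft (fun t => conjc (a t * ee (t * xi))) eta = conjc (ft a (xi - eta)).
Proof.
move=> ai; rewrite /ft -(CIJ (cL1_ft _ ai)); apply: eq_CI => t.
by rewrite mulrBr eeD eeN !conjcM conjcK mulrA.
Qed.

(* Expanding [ft F] and [ft G], the integral only involves [ft a] at differences
   of two points of [[-B, B]]. *)
Lemma bandlimited_pair_eq0 a F G (B : R) : cL1 a -> cL1 F -> cL1 G ->
  (forall x, B < `|x| -> F x = 0) -> (forall x, B < `|x| -> G x = 0) ->
  (forall w, `|w| <= 2 * B -> ft a w = 0) ->
  CI (fun t => a t * (ft F t * conjc (ft G t))) = 0.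
Proof.
move=> ai Fi Gi F0 G0 a0.
have GM t : normc (conjc (ft G t)) <= RI (fun x => normc (G x)).
  by rewrite cnormJ normc_ft.
have agi : cL1 (fun t => a t * conjc (ft G t)).
  by apply: cL1Mb GM => //; apply: cmeasJ; exact: cmeas_ft.
transitivity (CI (fun t => a t * conjc (ft G t) * ft F t)).
  by apply: eq_CI => t; ring.
rewrite (ft_mul agi Fi) -[RHS](@CI0 R); apply: eq_CI => xi.
have [xB|Bx] := leP `|xi| B; last by rewrite F0// mul0r.
suff -> : ft (fun t => a t * conjc (ft G t)) xi = 0 by rewrite mulr0.
have ai' := cL1J (cL1_ft xi ai).
transitivity (conjc (CI (fun t => conjc (a t * ee (t * xi)) * ft G t))).
  have i1 : cL1 (fun t => conjc (a t * ee (t * xi)) * ft G t) by exact: cL1_mul_ft.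
  rewrite -(CIJ i1); apply: eq_CI => t; rewrite !conjcM !conjcK; ring.
rewrite (ft_mul ai' Gi).
suff -> : CI (fun x => G x * ft (fun t => conjc (a t * ee (t * xi))) x) = 0.
  by apply: complex_eqP => //=; rewrite oppr0.
rewrite -[RHS](@CI0 R); apply: eq_CI => eta.
have [eB|Be] := leP `|eta| B; last by rewrite G0// mul0r.
rewrite ft_conj_modulate// a0; first by apply: complex_eqP; rewrite ?cReM ?cImM /=; ring.
apply: le_trans (ler_normB _ _) _; lra.
Qed.

Lemma ft_modulate F (u t : R) : ft (fun x => F x * ee (x * u)) t = ft F (t + u).
Proof.
apply: eq_CI => x; rewrite mulrDr eeD; ring.
Qed.

Lemma ft_ball_continuous F (u t0 : R) : cL1 F -> forall eta : R, 0 < eta ->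
  exists2 d : R, 0 < d & forall t, `|t - t0| < d -> normc (ft F (t + u) - ft F (t0 + u)) <= eta.
Proof.
move=> Fi eta eta0; have [d d0 hd] := ft_continuous Fi eta0.
exists d => // t td; apply: hd.
by rewrite (_ : t + u - (t0 + u) = t - t0)//; ring.
Qed.

Definition ccont (h : R -> R[i]) := forall t0 (eta : R), 0 < eta ->
  exists2 d : R, 0 < d & forall t, `|t - t0| < d -> normc (h t - h t0) <= eta.

Lemma ccont_ft F (u : R) : cL1 F -> ccont (fun t => ft F (t + u)).
Proof. by move=> Fi t0 eta; exact: ft_ball_continuous. Qed.

Lemma ccontJ h : ccont h -> ccont (fun t => conjc (h t)).
Proof.
move=> ch t0 eta /(ch t0)[d d0 hd]; exists d => // t /hd.
by rewrite -conjcB cnormJ.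
Qed.

Lemma ccontB h k : ccont h -> ccont k -> ccont (fun t => h t - k t).
Proof.
move=> ch ck t0 eta eta0; have e2 : 0 < eta / 2 by rewrite divr_gt0.
have [d1 d10 hd1] := ch t0 _ e2; have [d2 d20 hd2] := ck t0 _ e2.
exists (Num.min d1 d2) => [|t]; first by rewrite lt_min d10.
rewrite lt_min => /andP[t1 t2].
rewrite (_ : _ - _ - _ = (h t - h t0) - (k t - k t0)); last by ring.
apply: le_trans (le_normcB _ _) _; rewrite [leRHS](splitr eta).
by apply: lerD; [exact: hd1|exact: hd2].
Qed.

Lemma ccontM h k (M : R) : ccont h -> ccont k -> (forall t, normc (h t) <= M) ->
  (forall t, normc (k t) <= M) -> ccont (fun t => h t * k t).
Proof.
move=> ch ck hM kM t0 eta eta0.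
have M0 : 0 <= M := le_trans (normc_ge0 _) (hM 0).
have M1 : 0 < 2 * (M + 1) by rewrite mulr_gt0// ltr_wpDl.
have e2 : 0 < eta / (2 * (M + 1)) by rewrite divr_gt0.
have [d1 d10 hd1] := ch t0 _ e2; have [d2 d20 hd2] := ck t0 _ e2.
exists (Num.min d1 d2) => [|t]; first by rewrite lt_min d10.
rewrite lt_min => /andP[t1 t2].
rewrite (_ : _ - _ = (h t - h t0) * k t + h t0 * (k t - k t0)); last by ring.
apply: le_trans (le_normcD _ _) _; rewrite !normcM [leRHS](splitr eta).
have E : eta / (2 * (M + 1)) * M <= eta / 2.
  rewrite (_ : _ * M = eta / 2 * (M / (M + 1))).
    by rewrite ler_piMr ?divr_ge0 ?(ltW eta0)// ler_pdivrMr ?ltr_wpDl// mul1r lerDl.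
  by field; rewrite gt_eqF// ltr_wpDl.
apply: lerD; apply: le_trans E.
  by apply: ler_pM; rewrite ?normc_ge0//; exact: hd1.
by rewrite mulrC; apply: ler_pM; rewrite ?normc_ge0//; exact: hd2.
Qed.

Lemma CI_normsq_eq0 h (M : R) : cL2 h -> ccont h -> (forall t, normc (h t) <= M) ->
  CI (fun t => h t * conjc (h t)) = 0 -> forall t, h t = 0.
Proof.
move=> [mh h2] ch hM I0 t0; apply: normsq_eq0.
have hJM t : normc (conjc (h t)) <= M by rewrite cnormJ.
apply: (@RI_eq0_continuous (fun t => normsq (h t))) => //.
- by move=> x; exact: normsq_ge0.
- move: I0; rewrite (eq_CI (fun t => conjcMz (h t))) CI_real.
  by move=> /(congr1 (@complex.Re R)).
- move=> eta eta0; have [d d0 hd] := ccontM ch (ccontJ ch) hM hJM t0 eta0.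
  exists d => // t /hd; rewrite !conjcMz -rmorphB /= => H.
  by apply: le_trans H; rewrite -normc_real.
Qed.

(** Compactness of the segment and continuity of [ft k]: near each point half of the modulus there
    is a local lower bound. The inequality is strict so that it contradicts a bound by [m]. *)
Lemma ft_bounded_below k (r : R) : cL1 k -> (forall w, `|w| <= r -> ft k w != 0) ->
  exists2 m : R, 0 < m & forall w, `|w| <= r -> m < normc (ft k w).
Proof.
move=> ki k0.
have := @segment_compact R (- r) r; rewrite compact_near_coveringP.
move=> /(_ R (0 : R)^'+ (fun d w => d < normc (ft k w)) _).
have H : forall x, `[- r, r]%classic x -> \forall x' \near x & d \near (0 : R)^'+,
    d < normc (ft k x').
  move=> x xr; have kx : 0 < normc (ft k x).
    rewrite lt_neqAle normc_ge0 andbT eq_sym.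
    apply: contra (k0 x _); first by move=> /eqP/eq0_normc ->.
    by move: xr; rewrite /= in_itv /= ler_norml.
  have k2 : 0 < normc (ft k x) / 2 by rewrite divr_gt0.
  have [d0 d00 hd0] := ft_continuous ki k2.
  near=> x' d.
  have h1 : normc (ft k x - ft k x') <= normc (ft k x) / 2.
    by apply: hd0; near: x'; exact: nbhsx_ballx.
  have h2 : d < normc (ft k x) / 2 by near: d; exact: nbhs_right_lt.
  have : normc (ft k x) <= normc (ft k x - ft k x') + normc (ft k x').
    by apply: le_trans (le_normcD _ _); rewrite subrK.
  move=> h3; suff : d < normc (ft k x') by [].
  apply: lt_le_trans h2 _; move: h1 h3.
  move: (normc (ft k x - ft k x')) (normc (ft k x)) (normc (ft k x')) => p q s.
  by clear; move: p q s => p q s; lra.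
move=> /(_ H) [d /= d0 hd].
exists (d / 2); first by rewrite divr_gt0.
move=> w wr; apply: (hd (d / 2)) => //=.
- by rewrite sub0r normrN ger0_norm ?divr_ge0 ?(ltW d0)// ltr_pdivrMr// ltr_pMr// ltr1n.
- by rewrite divr_gt0.
- by rewrite in_itv /= -ler_norml.
Unshelve. all: by end_near. Qed.

End BandLimited.

(** * From equal spectrograms to equal local products *)

Section PhaseRetrieval.
Variable R : realType.

(** The transforms for [u] and for 0 differ, at every frequency at once, by at most the L^1 norm of
    [(conjc (phi (s + u)) - conjc (phi s)) * phi s]. For small [u] this is at most [m], while the
    transform for 0 exceeds [m] on the whole segment. *)
Lemma window_nonvanishing (phi : R -> R[i]) (r : R) : cL2 phi ->
  (forall w, `|w| <= r -> ft (fun s => conjc (phi s) * phi s) w != 0) ->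
  exists2 d : R, 0 < d & forall u w, `|u| < d -> `|w| <= r ->
    ft (fun s => conjc (phi (s + u)) * phi s) w != 0.
Proof.
move=> ph p0; have pJ := cL2J ph.
have [m m0 hm] := ft_bounded_below (cL2_mul pJ ph) p0.
have [d d0 hd] := translation_mul pJ ph m0.
exists d => // u w ud wr; apply/eqP => z.
have i1 := cL2_mul (cL2_shift u pJ) ph; have i2 := cL2_mul pJ ph.
have /le_lt_trans := hd u ud; move=> /(_ _ (hm w wr)); apply/negP; rewrite -leNgt.
rewrite -normcN -[X in normc X]add0r -z /ft -CIB; [|exact: cL1_ft|exact: cL1_ft].
apply: CI_le.
- by apply: cL1B; exact: cL1_ft.
- have := cL1_normc (cL1B i1 i2).
  by apply: eq_integrable => // x _ /=; rewrite -mulrBl normcM.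
- by move=> t; rewrite -mulrBl -mulrBl !normcM normc_ee mulr1.
Qed.

Lemma local_product_eq (phi F G : R -> R[i]) (B : R) : cL2 phi ->
  cL1 F -> cL2 F -> (forall x, B < `|x| -> F x = 0) ->
  cL1 G -> cL2 G -> (forall x, B < `|x| -> G x = 0) ->
  (forall w, `|w| <= 2 * B -> ft (fun s => conjc (phi s) * phi s) w != 0) ->
  (forall x v, normc (ft (fun t => ft F t * conjc (phi (t - x))) v) =
               normc (ft (fun t => ft G t * conjc (phi (t - x))) v)) ->
  exists2 d : R, 0 < d & forall u t, `|u| < d ->
    ft F (t + u) * conjc (ft F t) = ft G (t + u) * conjc (ft G t).
Proof.
move=> ph F1 F2 F0 G1 G2 G0 p0 FG.
have [d d0 hd] := window_nonvanishing ph p0.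
exists d => // u t ud.
pose f := ft F; pose g := ft G.
have mf : cmeas f by exact: cmeas_ft.
have mg : cmeas g by exact: cmeas_ft.
have f2 : cL2 f by split => //; apply: ft_L2 => //; case: F2.
have g2 : cL2 g by split => //; apply: ft_L2 => //; case: G2.
pose M := RI (fun x => normc (F x)) + RI (fun x => normc (G x)).
have I0 (h : R -> R[i]) : 0 <= RI (fun x => normc (h x)).
  by apply: RI_ge0 => x; exact: normc_ge0.
have fM s : normc (f s) <= M by apply: le_trans (normc_ft _ F1) _; rewrite lerDl.
have gM s : normc (g s) <= M by apply: le_trans (normc_ft _ G1) _; rewrite lerDr.
have M0 : 0 <= M by rewrite addr_ge0.
have pJ := cL2J ph.
pose psi s := conjc (phi (s + u)) * phi s.
have psi1 : cL1 psi by apply: cL2_mul => //; exact: (cL2_shift u pJ).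
pose P (h : R -> R[i]) s := h (s + u) * conjc (h s).
have P1 h : cL2 h -> cL1 (P h).
  by move=> hh; apply: cL2_mul; [exact: cL2_shift|exact: cL2J].
have PM (h : R -> R[i]) : (forall s, normc (h s) <= M) -> forall s, normc (P h s) <= M * M.
  by move=> hM s; rewrite normcM cnormJ; apply: ler_pM; rewrite ?normc_ge0.
have P2 h : cL2 h -> (forall s, normc (h s) <= M) -> cL2 (P h).
  move=> hh hM; apply: (cL2Mb (M := M)); first exact: cL2J.
    by case: (cL2_shift u hh).
  by move=> x; exact: hM.
pose D s := P f s - P g s.
have D1 : cL1 D by apply: cL1B; exact: P1.
have DM s : normc (D s) <= M * M + M * M.
  by apply: le_trans (le_normcB _ _) _; apply: lerD; exact: PM.
(* Regrouping the four factors separates the signal from the window: the autocorrelation at lag [u]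
   of each windowed signal is a value of one correlation in the variable [x]. *)
have acE (h : R -> R[i]) x : acorr (fun s => h s * conjc (phi (s - x))) u =
    CI (fun s => P h s * psi (s - x)).
  apply: eq_CI => s; rewrite /P /psi conjcM conjcK addrAC; ring.
have Ppsi h x : cL2 h -> (forall s, normc (h s) <= M) -> cL1 (fun s => P h s * psi (s + x)).
  move=> hh hM; under [X in cL1 X]eq_fun do rewrite mulrC.
  apply: (cL1Mb (M := M * M)); first exact: cL1_shift.
    by case: (P1 h hh) => /intg_measurable m1 /intg_measurable m2.
  exact: PM.
have C0 x : CI (fun s => D s * psi (s + x)) = 0.
  transitivity (CI (fun s => P f s * psi (s + x) - P g s * psi (s + x))).
    by apply: eq_CI => s; rewrite /D mulrBl.
  rewrite CIB; [|exact: Ppsi|exact: Ppsi].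
  have := acE f (- x); have := acE g (- x); rewrite opprK => <- <-.
  have hp h : cL2 h -> (forall s, normc (h s) <= M) ->
      cL1 (fun s => h s * conjc (phi (s + x))) /\ cL2 (fun s => h s * conjc (phi (s + x))).
    move=> hh hM; split; first by apply: cL2_mul => //; exact: (cL2_shift x pJ).
    by apply: (cL2Mb (M := M)) => //; [exact: (cL2_shift x pJ)|case: hh].
  have [a1 a2] := hp f f2 fM; have [b1 b2] := hp g g2 gM.
  have e v : normc (ft (fun s => f s * conjc (phi (s + x))) v) =
             normc (ft (fun s => g s * conjc (phi (s + x))) v).
    by have := FG (- x) v; rewrite opprK.
  by apply/eqP; rewrite subr_eq0; apply/eqP; exact: (acorr_unique a1 a2 b1 b2 e u).
(* [conv_eq0] is used at [- w]; the condition on [w] is symmetric, so the window factor is still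
   nonzero there. *)
have D0 w : `|w| <= 2 * B -> ft D w = 0.
  move=> wB; have := conv_eq0 D1 DM psi1 C0 (- w); rewrite opprK => /eqP.
  rewrite mulf_eq0 (negPf (hd u (- w) ud _)) ?normrN// orbF.
  by move=> /eqP.
have cP H : cL1 H -> (forall s, normc (ft H s) <= M) -> ccont (P (ft H)).
  move=> H1 HM; apply: (ccontM (M := M)).
  - exact: ccont_ft.
  - apply: ccontJ; have := ccont_ft 0 H1.
    by under [X in ccont X]eq_fun do rewrite addr0.
  - by move=> s; exact: HM.
  - by move=> s; rewrite cnormJ.
(* The shifted factor [ft H (s + u)] is the transform of [H x * ee (x * u)], which has the same
   support bound, so [bandlimited_pair_eq0] applies. *)
have pair0 (H : R -> R[i]) : cL1 H -> (forall x, B < `|x| -> H x = 0) ->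
    CI (fun s => D s * conjc (P (ft H) s)) = 0.
  move=> H1 H0; have Hu : cL1 (fun x => H x * ee (x * u)) by exact: cL1_ft.
  transitivity (CI (fun s => D s * (ft H s * conjc (ft (fun x => H x * ee (x * u)) s)))).
    apply: eq_CI => s; rewrite ft_modulate /P conjcM conjcK; congr (_ * _).
    by rewrite mulrC.
  apply: (bandlimited_pair_eq0 D1 H1 Hu H0 _ D0).
  by move=> x /H0 ->; rewrite mul0r.
suff : D t = 0 by rewrite /D => /eqP; rewrite subr_eq0 => /eqP.
apply: (@CI_normsq_eq0 _ D (M * M + M * M)) => //.
- by apply: cL2B; exact: P2.
- by apply: ccontB; exact: cP.
- have DP h : cL2 h -> (forall s, normc (h s) <= M) -> cL1 (fun s => D s * conjc (P h s)).
    move=> hh hM; apply: (cL1Mb (M := M * M)) => //.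
      by apply: cmeasJ; case: (P2 h hh hM).
    by move=> s; rewrite cnormJ; exact: PM.
  (* Expanding only the conjugated copy of [D] gives two integrals, each 0 by [pair0]. *)
  transitivity (CI (fun s => D s * conjc (P f s) - D s * conjc (P g s))).
    by apply: eq_CI => s; rewrite -mulrBr -conjcB.
  by rewrite CIB ?pair0 ?subrr//; exact: DP.
Qed.

End PhaseRetrieval.

(** * Moments and entire continuation *)

Section Moments.
Variable R : realType.
Implicit Types (H K : R -> R[i]) (B : R).

Definition supported B H := forall x : R, B < `|x| -> H x = 0.

Lemma cL1_supportedM B H (k : R -> R[i]) (M : R) : cL1 H -> supported B H -> cmeas k ->
  (forall x, `|x| <= B -> normc (k x) <= M) -> cL1 (fun x => H x * k x).
Proof.
move=> Hi H0 mk kM; apply: cL1_dom (intgZ M (cL1_normc Hi)).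
  exact: cmeasM (cL1_cmeas Hi) mk.
move=> x; have [xB|Bx] := leP `|x| B.
  by rewrite normcM mulrC ler_wpM2r ?normc_ge0//; exact: kM.
by rewrite H0// mul0r normc0 mulr0.
Qed.

Lemma supportedM B H (k : R -> R[i]) : supported B H -> supported B (fun x => H x * k x).
Proof. by move=> H0 x /H0 ->; rewrite mul0r. Qed.

Lemma cL1_supported_real B H (p : R -> R) (M : R) : cL1 H -> supported B H ->
  measurable_fun setT p -> (forall x, `|x| <= B -> `|p x| <= M) ->
  cL1 (fun x => H x * (p x)%:C%C).
Proof.
move=> Hi H0 mp pM; apply: (cL1_supportedM Hi H0 (M := M)); first exact: cmeas_real.
by move=> x /pM; rewrite normc_real.
Qed.

Lemma norm_le_sqr (f df : R -> R) : (forall x : R, is_derive x (1 : R) f (df x)) ->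
  f 0 = 0 -> (forall x, `|df x| <= `|x|) -> forall x, `|f x| <= x ^+ 2.
Proof.
move=> fd f0 dfx x.
have cf : continuous f by apply: derivable_continuous => y; exists (df y).
have [x0|x0|x0] := ltgtP 0 x; last by rewrite -x0 f0 normr0 expr0n.
  have [|c] := @MVT R f df 0 x x0; first exact: continuous_subspaceT.
  rewrite in_itv /= f0 !subr0 => /andP[c0 cx] ->.
  rewrite normrM (gtr0_norm x0) expr2 ler_wpM2r ?(ltW x0)//.
  by apply: le_trans (dfx c) _; rewrite gtr0_norm// ltW.
have [|c] := @MVT R f df x 0 x0; first exact: continuous_subspaceT.
rewrite in_itv /= f0 !sub0r => /andP[xc c0] e.
rewrite -normrN e normrM (_ : x ^+ 2 = - x * - x); last by rewrite mulrNN.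
rewrite (gtr0_norm (x := - x)) ?oppr_gt0// ler_wpM2r ?oppr_ge0 ?(ltW x0)//.
by apply: le_trans (dfx c) _; rewrite ltr0_norm// lerN2 ltW.
Qed.

(** Each component has an error at most [x ^+ 2], by the mean value theorem and the Lipschitz bounds
    of sine and cosine at 0; the constant 2 counts the components. *)
Lemma expi_taylor (x : R) : normc (expi x - 1 - Complex 0 x) <= 2 * x ^+ 2.
Proof.
have h1 : `|cos x - 1| <= x ^+ 2.
  apply: (@norm_le_sqr (fun x => cos x - 1) (fun x => - sin x)).
  - by move=> y; apply: is_derive_eq; rewrite subr0.
  - by rewrite cos0 subrr.
  - move=> y; rewrite normrN; have := sin_lipschitz y 0.
    by rewrite sin0 !subr0.
have h2 : `|sin x - x| <= x ^+ 2.
  apply: (@norm_le_sqr (fun x => sin x - x) (fun x => cos x - 1)).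
  - by rewrite sin0 subrr.
  - move=> y; have := cos_lipschitz y 0.
    by rewrite cos0 !subr0.
apply: le_trans (le_normc_ReIm _) _; rewrite !cReD !cImD !cReN !cImN /= !subr0.
lra.
Qed.

(** Up to the factor [2 pi i], the function in the conclusion is the derivative of [ft H]. A
    difference of two vanishing values, compared with its first-order term, gives [2 pi |L| <= C s]
    for all small [s > 0]. Bounded support makes [x * H x] integrable and the error uniform in
    [x]. *)
Lemma ft_derivative_vanishes B H (t0 d : R) : cL1 H -> supported B H ->
  (forall t, `|t - t0| < d -> ft H t = 0) ->
  forall t, `|t - t0| < d -> ft (fun x => H x * x%:C%C) t = 0.
Proof.
move=> Hi H0 hz t td.
have p0 := @pi_gt0 R.
have xi : cL1 (fun x => H x * x%:C%C) by apply: (cL1_supported_real (M := B) Hi H0).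
set L := ft _ t.
(* The Taylor error [2 * (2 pi x s) ^+ 2] is at most [8 pi^2 B^2 s^2] on the support. *)
pose C := 8 * pi ^+ 2 * B ^+ 2 * RI (fun x => normc (H x)).
have I0 : 0 <= RI (fun x => normc (H x)) by apply: RI_ge0 => x; exact: normc_ge0.
have c8 : 0 <= 8 * pi ^+ 2 :> R by apply: mulr_ge0 => //; exact: sqr_ge0.
have C0 : 0 <= C by apply: mulr_ge0 => //; apply: mulr_ge0 => //; exact: sqr_ge0.
pose e := d - `|t - t0|.
have e0 : 0 < e by rewrite subr_gt0.
have key (s : R) : 0 < s -> s < e -> normc L * (2 * pi) <= C * s.
  move=> s0 se.
  have z1 : ft H t = 0 by exact: hz.
  have z2 : ft H (t + s) = 0.
    apply: hz; rewrite addrAC; apply: le_lt_trans (ler_normD _ _) _.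
    by move: se; rewrite (gtr0_norm s0) /e => se; lra.
  have i1 := cL1_ft (t + s) Hi; have i2 := cL1_ft t Hi.
  have i3 := cL1Zl (Complex 0 (2 * pi * s)) (cL1_ft t xi).
  have E : CI (fun x => H x * ee (x * (t + s)) - H x * ee (x * t)
      - Complex 0 (2 * pi * s) * (H x * x%:C%C * ee (x * t))) = - (Complex 0 (2 * pi * s) * L).
    rewrite (CIB (cL1B i1 i2) i3) (CIB i1 i2) (CIZl _ (cL1_ft t xi)).
    by rewrite -/(ft H t) -/(ft H (t + s)) z1 z2 subrr sub0r.
  have Hb := intgZ (8 * pi ^+ 2 * B ^+ 2 * s ^+ 2) (cL1_normc Hi).
  have := CI_le (cL1B (cL1B i1 i2) i3) Hb.
  rewrite E normcN normcM (RIZ _ (cL1_normc Hi)).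
  have -> : normc (Complex 0 (2 * pi * s)) = 2 * pi * s.
    by rewrite /normc expr0n add0r sqrtr_sqr ger0_norm// !mulr_ge0// ltW.
  move=> bnd.
  have {}bnd : 2 * pi * s * normc L <= 8 * pi ^+ 2 * B ^+ 2 * s ^+ 2 * RI (fun x => normc (H x)).
    apply: bnd => x.
    have -> : H x * ee (x * (t + s)) - H x * ee (x * t) -
        Complex 0 (2 * pi * s) * (H x * x%:C%C * ee (x * t)) =
        H x * ee (x * t) * (expi (2 * pi * (x * s)) - 1 - Complex 0 (2 * pi * (x * s))).
      have -> : Complex 0 (2 * pi * (x * s)) = Complex 0 (2 * pi * s) * x%:C%C.
        by apply: complex_eqP; rewrite ?cReM ?cImM /=; ring.
      rewrite mulrDr eeD -/(ee (x * s)).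
      by move: (ee _) (ee _) (H x) (Complex _ _) (x%:C%C) => p q r v w; ring.
    have [xB|Bx] := leP `|x| B; last first.
      rewrite H0// !mul0r normc0 mulr_ge0 ?normc_ge0//.
      by apply: mulr_ge0; [apply: mulr_ge0 => //|]; exact: sqr_ge0.
    rewrite !normcM normc_ee mulr1 mulrC ler_wpM2r ?normc_ge0//.
    apply: le_trans (expi_taylor _) _.
    rewrite !exprMn.
    have x2 : x ^+ 2 <= B ^+ 2.
      rewrite -[leLHS]real_normK ?num_real// lerXn2r ?nnegrE//.
      exact: le_trans xB.
    rewrite (_ : 2 * (2 ^+ 2 * pi ^+ 2 * (x ^+ 2 * s ^+ 2)) =
        8 * pi ^+ 2 * s ^+ 2 * x ^+ 2); last by ring.
    rewrite (_ : 8 * pi ^+ 2 * B ^+ 2 * s ^+ 2 = 8 * pi ^+ 2 * s ^+ 2 * B ^+ 2); last by ring.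
    by rewrite ler_wpM2l//; apply: mulr_ge0 => //; exact: sqr_ge0.
  rewrite -(ler_pM2r s0); apply: le_trans (le_trans bnd _);
    rewrite le_eqVlt; apply/orP; left; apply/eqP.
    by ring.
  by rewrite /C; ring.
apply: eq0_normc; apply/eqP; rewrite eq_le normc_ge0 andbT leNgt; apply/negP => L0.
have a0 : 0 < normc L * (2 * pi) by rewrite mulr_gt0// mulr_gt0.
(* The second argument makes [C * s] at most half of the positive quantity that it should
   dominate. *)
pose s := Num.min (e / 2) (normc L * (2 * pi) / (2 * (C + 1))).
have C1 : 0 < C + 1 by rewrite ltr_wpDl.
have s0 : 0 < s by rewrite lt_min !divr_gt0// mulr_gt0.
have se : s < e.
  by apply: (@le_lt_trans _ _ (e / 2)); [rewrite ge_min lexx|lra].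
have := key s s0 se; apply/negP; rewrite -ltNge.
apply: (@le_lt_trans _ _ ((C + 1) * s)); first by rewrite ler_wpM2r ?(ltW s0)// lerDl.
apply: (@le_lt_trans _ _ ((C + 1) * (normc L * (2 * pi) / (2 * (C + 1))))).
  by rewrite ler_pM2l// ge_min lexx orbT.
rewrite (_ : (C + 1) * (normc L * (2 * pi) / (2 * (C + 1))) = normc L * (2 * pi) / 2).
  by lra.
by field; rewrite gt_eqF.
Qed.

Definition zero_moments K := forall n, CI (fun x => K x * (x ^+ n)%:C%C) = 0.

(** Iterating [ft_derivative_vanishes]: each factor [x] preserves the support and the vanishing on
    the same interval. Evaluating at [t0] gives the moments. *)
Lemma zero_moments_of_ft B H (t0 d : R) : 0 < d -> cL1 H -> supported B H ->
  (forall t, `|t - t0| < d -> ft H t = 0) -> zero_moments (fun x => H x * ee (x * t0)).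
Proof.
move=> d0 Hi H0 hz n.
suff [_ _ /(_ t0)] : [/\ cL1 (fun x => H x * (x ^+ n)%:C%C),
    supported B (fun x => H x * (x ^+ n)%:C%C) &
    forall t, `|t - t0| < d -> ft (fun x => H x * (x ^+ n)%:C%C) t = 0].
  rewrite subrr normr0 => /(_ d0) <-; apply: eq_CI => x; ring.
elim: n => [|n [i1 i2 i3]].
  by under [X in cL1 X]eq_fun do rewrite expr0 mulr1;
    under [X in supported _ X]eq_fun do rewrite expr0 mulr1;
    under [X in ft X]eq_fun do rewrite expr0 mulr1.
have E x : H x * (x ^+ n.+1)%:C%C = H x * (x ^+ n)%:C%C * x%:C%C.
  by rewrite -mulrA -rmorphM /= exprSr.
rewrite (funext E); split.
- exact: (cL1_supported_real (M := B) i1 i2).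
- exact: supportedM.
- exact: (ft_derivative_vanishes i1 i2).
Qed.

(** Partial sums are handled by linearity, the limit by dominated convergence on the support. The
    conclusion again speaks of all moments, so that several entire factors can be multiplied in one
    after another. *)
Lemma zero_moments_series B K (c : nat -> R) (p : R -> R) (M : R) :
  cL1 K -> supported B K -> zero_moments K -> measurable_fun setT p ->
  (forall x, (fun n => \sum_(0 <= k < n) c k * x ^+ k) @ \oo --> p x) ->
  (forall n x, `|x| <= B -> `|\sum_(0 <= k < n) c k * x ^+ k| <= M) ->
  cL1 (fun x => K x * (p x)%:C%C) /\ zero_moments (fun x => K x * (p x)%:C%C).
Proof.
move=> Ki K0 Kz mp cp bp.
pose pn n x := \sum_(0 <= k < n) c k * x ^+ k.
have pM x : `|x| <= B -> `|p x| <= M.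
  move=> xB; have := cp x => /cvg_norm h.
  rewrite -(cvg_lim _ h)//; apply: limr_le; first exact: (cvgP _ h).
  by near=> n; exact: bp.
have Kpi := cL1_supported_real Ki K0 mp pM.
split => // m.
have mpn n : measurable_fun setT (pn n).
  apply: measurable_sum => k; apply: measurable_funM => //.
have mX (k : nat) : measurable_fun setT (fun x : R => x ^+ k) by exact: measurable_funX.
have Xm (k : nat) x : `|x| <= B -> `|x ^+ k| <= B ^+ k.
  by move=> xB; rewrite normrX lerXn2r ?nnegrE// (le_trans _ xB).
have Kn n : cL1 (fun x => K x * (pn n x)%:C%C).
  exact: (cL1_supported_real Ki K0 (mpn n) (bp n)).
have KX k h : cL1 h -> supported B h -> cL1 (fun x => h x * (x ^+ k)%:C%C).
  by move=> hi h0; exact: (cL1_supported_real hi h0 (mX k) (Xm k)).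
have Kmi (k : nat) : cL1 (fun x => K x * (x ^+ k)%:C%C).
  exact: KX.
have zn n : cL1 (fun x => K x * (pn n x)%:C%C * (x ^+ m)%:C%C) /\
    CI (fun x => K x * (pn n x)%:C%C * (x ^+ m)%:C%C) = 0.
  have i0 : cL1 (fun x => K x * (pn n x)%:C%C * (x ^+ m)%:C%C).
    by apply: KX => //; exact: supportedM.
  split => //; elim: n i0 => [|n IH] i0.
    rewrite -[RHS](@CI0 R); apply: eq_CI => x.
    by rewrite /pn big_geq// mulr0 mul0r.
  have i1 : cL1 (fun x => K x * (pn n x)%:C%C * (x ^+ m)%:C%C).
    by apply: KX => //; exact: supportedM.
  have E x : K x * (pn n.+1 x)%:C%C * (x ^+ m)%:C%C =
      K x * (pn n x)%:C%C * (x ^+ m)%:C%C + (c n)%:C%C * (K x * (x ^+ (n + m))%:C%C).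
    rewrite /pn big_nat_recr//= exprD !rmorphD !rmorphM /=.
    by move: (K x) (_ %:C)%C (_ %:C)%C (_ %:C)%C (_ %:C)%C => *; ring.
  rewrite (eq_CI E) (CID i1 (cL1Zl _ (Kmi _))) IH// (CIZl _ (Kmi _)) Kz.
  by rewrite mulr0 addr0.
have Kpm : cL1 (fun x => K x * (p x)%:C%C * (x ^+ m)%:C%C).
  by apply: KX => //; exact: supportedM.
pose f_ n (x : R) : R :=
  normc (K x * (p x)%:C%C * (x ^+ m)%:C%C - K x * (pn n x)%:C%C * (x ^+ m)%:C%C).
have f_E n x : f_ n x = normc (K x) * `|x ^+ m| * `|p x - pn n x|.
  rewrite /f_ (_ : _ - _ = K x * (x ^+ m)%:C%C * (p x - pn n x)%:C%C).
    by rewrite !normcM !normc_real.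
  by rewrite rmorphB /=; ring.
have mf n : measurable_fun setT (f_ n).
  by apply: measurable_normc; apply: cmeasB; apply: cL1_cmeas => //; case: (zn n).
have fg n x : `|f_ n x| <= B ^+ m * (M + M) * normc (K x).
  rewrite ger0_norm ?normc_ge0// f_E.
  have [xB|Bx] := leP `|x| B; last by rewrite K0// normc0 !mul0r mulr0.
  rewrite -mulrA mulrC ler_wpM2r ?normc_ge0//; apply: ler_pM => //; first exact: Xm.
  by apply: le_trans (ler_normB _ _) _; apply: lerD; [exact: pM|exact: bp].
have f0 x : f_ n x @[n --> \oo] --> (0 : R).
  have := cvgM (cvg_cst (normc (K x) * `|x ^+ m|)) (cvg_norm (cvgB (cvg_cst (p x)) (cp x))).
  rewrite subrr normr0 mulr0 => h.
  rewrite (_ : (fun n => f_ n x) = (fun n => normc (K x) * `|x ^+ m| * `|p x - pn n x|)).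
    exact: h.
  by apply/funext => n; exact: f_E.
apply: eq0_normc; apply/eqP; rewrite eq_le normc_ge0 andbT leNgt; apply/negP => a0.
have [n] := dominated_small mf (intgZ _ (cL1_normc Ki)) fg f0 a0.
apply/negP; rewrite -leNgt; apply: le_trans (ler_norm _).
have [i1 z1] := zn n.
rewrite -[X in normc X]subr0 -z1 -CIB//.
exact: normc_CI (cL1B Kpm i1).
Unshelve. all: by end_near. Qed.

Lemma zero_moments_entire B K (c : nat -> R) (p : R -> R) (r : R) :
  cL1 K -> supported B K -> zero_moments K -> measurable_fun setT p ->
  (forall x, series (fun k => c k * x ^+ k) @ \oo --> p x) ->
  0 <= r -> (forall k, `|c k| <= r ^+ k / k`!%:R) ->
  cL1 (fun x => K x * (p x)%:C%C) /\ zero_moments (fun x => K x * (p x)%:C%C).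
Proof.
move=> Ki K0 Kz mp cp r0 cr.
(* The coefficients are dominated by those of the exponential of [r * x], so on the support all
   partial sums are bounded by [expR (r * B)]. *)
apply: (@zero_moments_series B K c p (expR (r * B)) Ki K0 Kz mp cp) => n x xB.
apply: (@le_trans _ _ (series (exp_coeff (r * `|x|)) n)).
  apply: le_trans (ler_norm_sum _ _ _) _; apply: ler_sum => k _.
  rewrite normrM normrX /exp_coeff /= exprMn mulrAC.
  by rewrite ler_wpM2r// exprn_ge0.
apply: (@le_trans _ _ (expR (r * `|x|))); last by rewrite ler_expR ler_wpM2l.
rewrite /expR; apply: nondecreasing_cvgn_le; last exact: is_cvg_series_exp_coeff.
apply: nondecreasing_series => k _; rewrite /exp_coeff /= divr_ge0//.
by rewrite exprn_ge0// mulr_ge0.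
Qed.

Lemma normr_sign_half (b : bool) (k : nat) : `|b%:R * (-1) ^+ k| <= 1 :> R.
Proof. by rewrite normrM normrX normrN1 expr1n mulr1; case: b; rewrite ?normr1 ?normr0. Qed.

Lemma zero_moments_expR B K (b : R) : cL1 K -> supported B K -> zero_moments K ->
  cL1 (fun x => K x * (expR (b * x))%:C%C) /\ zero_moments (fun x => K x * (expR (b * x))%:C%C).
Proof.
move=> Ki K0 Kz.
apply: (@zero_moments_entire B K (fun k => b ^+ k / k`!%:R) _ `|b|) => //.
- by apply: measurableT_comp => //; exact: measurable_funM.
- move=> x; rewrite /expR (_ : (fun k => _) = exp_coeff (b * x)).
    exact: is_cvg_series_exp_coeff.
  by apply/funext => k; rewrite /exp_coeff /= exprMn mulrAC.
- by move=> k; rewrite normrM normrX (ger0_norm (x := _^-1)).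
Qed.

Lemma zero_moments_cos B K (b : R) : cL1 K -> supported B K -> zero_moments K ->
  cL1 (fun x => K x * (cos (b * x))%:C%C) /\ zero_moments (fun x => K x * (cos (b * x))%:C%C).
Proof.
move=> Ki K0 Kz.
apply: (@zero_moments_entire B K
  (fun k => (~~ odd k)%:R * (-1) ^+ k./2 * (b ^+ k / k`!%:R)) _ `|b|) => //.
- apply: measurableT_comp; last exact: measurable_funM.
  by apply: continuous_measurable_fun; exact: continuous_cos.
- move=> x; rewrite unlock (_ : (fun k => _) = cos_coeff (b * x)).
    exact: is_cvg_series_cos_coeff.
  by apply/funext => k; rewrite cos_coeffE /= exprMn; ring.
- move=> k; rewrite normrM [X in _ * X]normrM normrX (ger0_norm (x := _^-1))//.
  by rewrite ler_piMl ?normr_sign_half// divr_ge0// exprn_ge0.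
Qed.

Lemma zero_moments_sin B K (b : R) : cL1 K -> supported B K -> zero_moments K ->
  cL1 (fun x => K x * (sin (b * x))%:C%C) /\ zero_moments (fun x => K x * (sin (b * x))%:C%C).
Proof.
move=> Ki K0 Kz.
apply: (@zero_moments_entire B K
  (fun k => (odd k)%:R * (-1) ^+ k.-1./2 * (b ^+ k / k`!%:R)) _ `|b|) => //.
- apply: measurableT_comp; last exact: measurable_funM.
  by apply: continuous_measurable_fun; exact: continuous_sin.
- move=> x; rewrite unlock (_ : (fun k => _) = sin_coeff (b * x)).
    exact: is_cvg_series_sin_coeff.
  by apply/funext => k; rewrite sin_coeffE /= exprMn; ring.
- move=> k; rewrite normrM [X in _ * X]normrM normrX (ger0_norm (x := _^-1))//.
  by rewrite ler_piMl ?normr_sign_half// divr_ge0// exprn_ge0.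
Qed.

(** The kernel [cexp2pii x z] is [ee (x * t0)] times a real exponential, times a cosine plus [i]
    times a sine, all with arguments linear in [x]. The first factor is absorbed in the moments at
    [t0], the others are power series, and the result is the moment of order 0. *)
Lemma ft_eq0_entire B H (t0 d : R) : 0 < d -> cL1 H -> supported B H ->
  (forall t, `|t - t0| < d -> ft H t = 0) ->
  forall z : R[i], CI (fun x => H x * cexp2pii x z) = 0.
Proof.
move=> d0 Hi H0 hz z.
pose K x := H x * ee (x * t0).
have Ki : cL1 K by exact: cL1_ft.
have K0 : supported B K by exact: supportedM.
have Kz : zero_moments K by exact: (zero_moments_of_ft d0 Hi H0 hz).
have [Li Lz] := zero_moments_expR (- (2 * pi * Im z)) Ki K0 Kz.
set L := (fun x => _) in Li Lz.
have L0 : supported B L by exact: supportedM.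
pose c := 2 * pi * (Re z - t0).
have [ci /(_ 0%N) cz] := zero_moments_cos c Li L0 Lz.
have [si /(_ 0%N) sz] := zero_moments_sin c Li L0 Lz.
have one h : CI (fun x => h x * (x ^+ 0)%:C%C) = CI h.
  by apply: eq_CI => x; rewrite expr0 mulr1.
rewrite one in cz; rewrite one in sz.
have E x : H x * cexp2pii x z =
    L x * (cos (c * x))%:C%C + Complex 0 1 * (L x * (sin (c * x))%:C%C).
  have -> : cexp2pii x z = (expR (- (2 * pi * Im z) * x))%:C%C * ee (x * Re z).
    rewrite /cexp2pii (_ : 2 * pi * x * Im z = 2 * pi * Im z * x); last by ring.
    rewrite mulNr (_ : 2 * pi * x * Re z = 2 * pi * (x * Re z)); last by ring.
    by apply: complex_eqP; rewrite ?cReM ?cImM /=; ring.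
  have -> : ee (x * Re z) = ee (x * t0) * ((cos (c * x))%:C%C + Complex 0 1 * (sin (c * x))%:C%C).
    have -> : (cos (c * x))%:C%C + Complex 0 1 * (sin (c * x))%:C%C = ee (x * (Re z - t0)).
      rewrite /ee /expi (_ : 2 * pi * (x * (Re z - t0)) = c * x); last by rewrite /c; ring.
      by apply: complex_eqP; rewrite ?cReD ?cImD ?cReM ?cImM /=; ring.
    by rewrite -eeD; congr ee; ring.
  rewrite /L /K.
  by move: (H x) (_%:C)%C (ee _) (_%:C)%C (_%:C)%C (Complex 0 1) => *; ring.
by rewrite (eq_CI E) (CID ci (cL1Zl _ si)) (CIZl _ si) cz sz mulr0 addr0.
Qed.

End Moments.

(** * The theorem *)

Section PaleyWiener.
Variable R : realType.

(* [F] is the spectrum of [f], extended by [0] outside of [[-B, B]] so that all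
   integrals can be taken over the whole line. *)
Lemma PW_ft (B : R) (f : R[i] -> R[i]) : PW B f -> exists F : R -> R[i],
  [/\ cL1 F, cL2 F, supported B F, (forall t, restrR f t = ft F t) &
      forall z, f z = CI (fun x => F x * cexp2pii x z)].
Proof.
move=> [F0 [[[m1 m2] i2] fE]].
pose D : set R := `[- B, B]%classic.
have mD : measurable D by exact: measurable_itv.
pose F x : R[i] := if x \in D then F0 x else 0.
have FRe : (fun x => Re (F x)) = (fun x => Re (F0 x)) \_ D.
  by apply/funext => x; rewrite patchE /F; case: ifP.
have FIm : (fun x => Im (F x)) = (fun x => Im (F0 x)) \_ D.
  by apply/funext => x; rewrite patchE /F; case: ifP.
have mF : cmeas F.
  by rewrite /cmeas FRe FIm; split; apply/(measurable_restrictT _ mD).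
have F2 : intg (fun x => normsq (F x)).
  have := i2; rewrite integrable_mkcond//.
  apply: eq_integrable => // x _ /=.
  by rewrite patchE /F; case: ifP => // _; rewrite /normsq /= expr0n addr0.
have supp : supported B F.
  move=> x Bx; rewrite /F ifF//; apply/negbTE/negP; rewrite inE /D /= in_itv/= => h.
  by move: Bx; rewrite ltNge ler_norml h.
have F1 : cL1 F.
  (* On the support, which has finite length, [normc (F x) <= normsq (F x) + 1]; thus a
     square-integrable spectrum is integrable. *)
  apply: cL1_dom mF _ (intgD F2 (intg_box B)) => x.
  have [xB|Bx] := leP `|x| B; last first.
    by rewrite supp// normc0 addr_ge0// normsq_ge0.
  rewrite indicE mem_set ?normc_sq; last exact/boxP.
  rewrite -normc_sq; have := sqr_ge0 (normc (F x) - 1).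
  have := normc_ge0 (F x); rewrite (_ : true%:R = 1 :> R)//.
  by move: (normc (F x)) => a a0; rewrite !expr2; nra.
have fE' z : f z = CI (fun x => F x * cexp2pii x z).
  rewrite fE /cint; apply: complex_eqP => /=; rewrite Rintegral_mkcond;
    congr (Rintegral _ _ _); apply/funext => x; rewrite patchE /F;
    by case: ifP => // _; rewrite mul0r.
exists F; split => // t.
rewrite /restrR fE'; apply: eq_CI => x; congr (_ * _).
rewrite /cexp2pii /ee /expi /= mulr0 oppr0 expR0 !mul1r.
by rewrite mulrA.
Qed.

Lemma STFT_ft (phi f : R -> R[i]) (x w : R) :
  STFT phi f x w = ft (fun t => f t * conjc (phi (t - x))) (- w).
Proof.
by apply: eq_CI => t; rewrite /ee; congr (_ * expi _); ring.
Qed.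

Lemma normC_inj (z w : R[i]) : `|z| = `|w| -> normc z = normc w.
Proof. by rewrite !normCE => /(congr1 (@complex.Re R)). Qed.

(** The angle [acos a] has the right cosine, and its sine is [b] up to sign; changing the sign of
    the angle corrects this. *)
Lemma unimodular_expi (c : R[i]) : normsq c = 1 -> exists alpha, c = expi alpha.
Proof.
case: c => a b; rewrite /normsq /= => ab.
have a1 : -1 <= a <= 1.
  rewrite -ler_norml -(@ler_pXn2r _ 2)// ?nnegrE// expr1n real_normK ?num_real//.
  by rewrite -ab lerDl sqr_ge0.
have s2 : sin (acos a) ^+ 2 = b ^+ 2.
  have := cos2Dsin2 (acos a); rewrite acosK// => h; lra.
have : (sin (acos a) == b) || (sin (acos a) == - b) by rewrite -eqf_sqr s2.
case/orP => /eqP sb.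
  by exists (acos a); rewrite /expi acosK// sb.
by exists (- acos a); rewrite /expi cosN sinN acosK// sb opprK.
Qed.

Lemma cL1_cexp (B : R) (F : R -> R[i]) z : cL1 F -> supported B F ->
  cL1 (fun x => F x * cexp2pii x z).
Proof.
move=> F1 F0.
apply: (cL1_supportedM (M := expR (2 * pi * B * `|Im z|)) F1 F0).
  split => /=; apply: measurable_funM.
  - apply: measurableT_comp => //; apply: measurableT_comp => //.
    by apply: measurable_funM => //; exact: measurable_funM.
  - apply: measurableT_comp; first by apply: continuous_measurable_fun; exact: continuous_cos.
    by apply: measurable_funM => //; exact: measurable_funM.
  - apply: measurableT_comp => //; apply: measurableT_comp => //.
    by apply: measurable_funM => //; exact: measurable_funM.
  - apply: measurableT_comp; first by apply: continuous_measurable_fun; exact: continuous_sin.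
    by apply: measurable_funM => //; exact: measurable_funM.
move=> x xB.
have -> : cexp2pii x z = (expR (- (2 * pi * x * Im z)))%:C%C * expi (2 * pi * x * Re z).
  by apply: complex_eqP; rewrite ?cReM ?cImM /=; ring.
rewrite normcM normc_expi mulr1 normc_real ger0_norm ?expR_ge0// ler_expR.
apply: le_trans (ler_norm _) _; rewrite normrN !normrM.
rewrite ler_wpM2r// (ger0_norm (pi_ge0 R)) (ger0_norm (ler0n _ 2)).
by rewrite ler_wpM2l// mulr_ge0// pi_ge0.
Qed.

End PaleyWiener.

Theorem theorem3p2 (R : realType) (B : R) (hB : 0 < B) (phi : R -> R[i])
  (hphi : L2on setT phi)
  (hA : forall omega : R, - (2 * B) <= omega <= 2 * B -> ambig phi 0 omega != 0)
  (f g : R[i] -> R[i]) (hf : PW B f) (hg : PW B g) :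
  (exists alpha : R, forall z : R[i], f z = expi alpha * g z) <->
  (forall x omega : R,
     `|STFT phi (restrR f) x omega| = `|STFT phi (restrR g) x omega|).
Proof.
have [F [F1 F2 F0 fF fz]] := PW_ft hf.
have [G [G1 G2 G0 gG gz]] := PW_ft hg.
have ph : cL2 phi by [].
have -> : restrR f = ft F by exact/funext.
have -> : restrR g = ft G by exact/funext.
have g2 : cL2 (ft G).
  by split; [exact: cmeas_ft|apply: ft_L2 => //; case: G2].
have pshift x : cL2 (fun t => conjc (phi (t - x))).
  exact: (cL2_shift (- x) (cL2J ph)).
split.
  move=> [alpha fg] x w.
  have fgR t : ft F t = expi alpha * ft G t by rewrite -fF -gG /restrR fg.
  have gi : cL1 (fun t => ft G t * conjc (phi (t - x))) by exact: cL2_mul.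
  have -> : STFT phi (ft F) x w = expi alpha * STFT phi (ft G) x w.
    rewrite (STFT_ft phi (ft F)) (STFT_ft phi (ft G)).
    transitivity (CI (fun t => expi alpha * (ft G t * conjc (phi (t - x)) * ee (t * - w)))).
      by apply: eq_CI => t; rewrite fgR !mulrA.
    exact: (CIZl _ (cL1_ft _ gi)).
  by rewrite !normCE normcM normc_expi mul1r.
move=> FG.
(* At [x = 0] the ambiguity function is a phase times the transform of [normsq phi] at [- omega];
   the interval is symmetric, so the reflection is harmless. *)
have p0 w : `|w| <= 2 * B -> ft (fun s => conjc (phi s) * phi s) w != 0.
  move=> wB; have := hA (- w); rewrite -ler_norml normrN => /(_ wB).
  apply: contra => /eqP z; rewrite /ambig STFT_ft opprK.
  rewrite (_ : ft _ w = 0) ?mulr0//; rewrite -z; apply: eq_CI => s.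
  by rewrite subr0; congr (_ * _); rewrite mulrC.
have FG' x v : normc (ft (fun t => ft F t * conjc (phi (t - x))) v) =
    normc (ft (fun t => ft G t * conjc (phi (t - x))) v).
  have := FG x (- v); rewrite (STFT_ft phi (ft F)) (STFT_ft phi (ft G)) (opprK v).
  exact: normC_inj.
have [d d0 hd] := local_product_eq ph F1 F2 F0 G1 G2 G0 p0 FG'.
(* The lag [u = 0] already gives equality of moduli on the real line. *)
have nE t : normsq (ft F t) = normsq (ft G t).
  have := hd 0 t; rewrite normr0 addr0 => /(_ d0); rewrite !conjcMz.
  by move=> /(congr1 (@complex.Re R)).
have [gz0|/existsNP[t0 gt0]] := pselect (forall t, ft G t = 0).
  (* If [g] vanishes on the line, so does [f] by equality of moduli; both are then 0 in the whole
     plane and any phase will do. *)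
  exists 0 => z; rewrite expi0 mul1r fz gz.
  rewrite (ft_eq0_entire (t0 := 0) (d := 1) _ F1 F0)//; last first.
    by move=> t _; apply: normsq_eq0; rewrite nE gz0 /normsq /= expr0n addr0.
  by rewrite (ft_eq0_entire (t0 := 0) (d := 1) _ G1 G0).
have fc0 : conjc (ft F t0) != 0.
  apply/eqP => h; apply: gt0; apply: normsq_eq0; rewrite -nE -normsqJ h.
  by rewrite /normsq /= expr0n addr0.
(* Read off from the local identity at base point [t0] and lag [t - t0], which says
   [f t * conjc (f t0) = g t * conjc (g t0)]. Equality of moduli at [t0] makes [c] unimodular. *)
pose c := conjc (ft G t0) / conjc (ft F t0).
have c1 : normsq c = 1.
  have n0 : normsq (conjc (ft F t0)) != 0.
    by apply: contra fc0 => /eqP/normsq_eq0 ->.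
  apply: (mulIf n0); rewrite -normsqM mulfVK// mul1r !normsqJ.
  by rewrite nE.
have [alpha ca] := unimodular_expi c1.
exists alpha => z; rewrite -ca.
(* The spectrum of [f - c * g]: its transform vanishes on an interval around [t0], hence its entire
   continuation vanishes everywhere. *)
pose H x := F x - c * G x.
have cG1 := cL1Zl c G1.
have H1 : cL1 H by exact: cL1B.
have H0 : supported B H by move=> x Bx; rewrite /H F0// G0// mulr0 subr0.
have Hz t : `|t - t0| < d -> ft H t = 0.
  move=> td; transitivity (ft F t - c * ft G t).
    rewrite /ft -(CIZl _ (cL1_ft _ G1)) -CIB; [|exact: cL1_ft|by apply: cL1Zl; exact: cL1_ft].
    by apply: eq_CI => x; rewrite /H; ring.
  have := hd (t - t0) t0 td; rewrite [t0 + _]addrC subrK => h.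
  apply: (mulIf fc0); rewrite mulrBl h mul0r mulrAC /c mulfVK// mulrC subrr//.
have := ft_eq0_entire d0 H1 H0 Hz z.
have iF := cL1_cexp z F1 F0; have iG := cL1_cexp z G1 G0.
have -> : CI (fun x => H x * cexp2pii x z) = f z - c * g z.
  rewrite fz gz -(CIZl _ iG) -(CIB iF (cL1Zl c iG)).
  by apply: eq_CI => x; rewrite /H; ring.
by move=> /eqP; rewrite subr_eq0 => /eqP.
Qed.
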